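(* Let $n\ge 1$ be an integer and let $G$ be an $n$-relator group (i.e. $G$ has a presentation with $n$ relators) that acts by isometries on a $1$-hyperbolic space with minimal displacement greater than $100\log_2((n+1)!)$. Then $G$ has cohomological dimension $\le 2$.
   Context: Distances in a metric space are written $|p-q|$, and the Gromov product is $\langle p,q\rangle_r=\tfrac12(|p-r|+|q-r|-|p-q|)$. A $\delta$-hyperbolic space ($\delta\ge 0$) is a nonempty geodesic metric space such that (i) $\langle p,q\rangle_r\ge\min(\langle p,s\rangle_r,\langle s,q\rangle_r)-\delta$ for all points $p,q,r,s$; and (ii) all geodesic triangles are $\delta$-thin: if $p(t),q(t)$ are arc length parametrizations, starting at $r$, of geodesics $[r,p]$ and $[r,q]$, then $|p(t)-q(t)|\le\delta$ for $0\le t\le\langle p,q\rangle_r$. The minimal displacement of an isometric action of $G$ on $\mathcal H$ is $\inf_{g\in G\setminus\{1\},\,p\in\mathcal H}|g\cdot p-p|$. The cohomological dimension of $G$ is the minimal length of a free $\mathbb Z[G]$-resolution of the trivial module $\mathbb Z$. *)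

(* Defs.v *)
From HB Require Import structures.
From mathcomp Require Import all_boot all_order all_algebra.
From mathcomp Require Import finmap.
(* monalg has to be imported before MathComp-Analysis: in the other order,
   their notations clash. *)
From mathcomp.multinomials Require Import monalg.
From mathcomp Require Import all_classical all_reals all_analysis.

Set Implicit Arguments.
Unset Strict Implicit.
Unset Printing Implicit Defensive.

Import Order.TTheory GRing.Theory Num.Theory.

Local Open Scope classical_set_scope.
Local Open Scope ring_scope.

(* The letter (x, false) stands for the generator x, and (x, true) for its
   inverse. *)
Definition letter (X : choiceType) : choiceType := (X * bool)%type.

Section FreeGroup.
Variable X : choiceType.
Implicit Types (l : letter X) (s t w : seq (letter X)).

Definition letter_inv l : letter X := (l.1, ~~ l.2).

Definition reduced_word w := sorted (fun a b => b != letter_inv a) w.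

(* Left multiplication of a reduced word by a letter. *)
Definition push l w :=
  if w is h :: t then if h == letter_inv l then t else l :: w else [:: l].

Definition word_mul s t := foldr push t s.

Definition word_inv s := rev (map letter_inv s).

Record free_group := FreeGroup {
  free_group_word :> seq (letter X);
  free_group_reduced : reduced_word free_group_word }.

HB.instance Definition _ := [isSub for free_group_word].
HB.instance Definition _ := [Choice of free_group by <:].

Lemma letter_invK : involutive letter_inv.
Proof. by case=> x b; rewrite /letter_inv /= negbK. Qed.

Lemma reduced_push l w : reduced_word w -> reduced_word (push l w).
Proof.
case: w => [|h t] //= ht; case: ifPn => [_|hl]; first exact: path_sorted ht.
by rewrite /reduced_word /= hl.
Qed.

Lemma reduced_word_mul s t : reduced_word t -> reduced_word (word_mul s t).
Proof. by move=> rt; elim: s => //= l s; apply: reduced_push. Qed.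

Lemma reduced_word_inv s : reduced_word s -> reduced_word (word_inv s).
Proof.
rewrite /reduced_word /word_inv rev_sorted sorted_map.
apply: sub_sorted => a b /=; apply: contraNneq => ab.
by rewrite ab letter_invK.
Qed.

Lemma push_inv l w : reduced_word w -> push (letter_inv l) (push l w) = w.
Proof.
case: w => [|h t] /=; first by rewrite letter_invK eqxx.
case: (eqVneq h (letter_inv l)) => [->|hl _] /=.
  by case: t => [|k t] //= /andP[/negPf ->].
by rewrite letter_invK eqxx.
Qed.

Lemma word_mul_push l s w : reduced_word w ->
  word_mul (push l s) w = push l (word_mul s w).
Proof.
case: s => [|h t] //= rw; case: eqVneq => [->|//].
by rewrite -{1}[l]letter_invK push_inv// reduced_word_mul.
Qed.

Lemma word_mul0 s : reduced_word s -> word_mul s [::] = s.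
Proof.
elim: s => //= l s IHs rs; rewrite (IHs (path_sorted rs)).
by case: s rs {IHs} => //= h t /andP[/negPf ->].
Qed.

Lemma word_mulA s t w : reduced_word w ->
  word_mul s (word_mul t w) = word_mul (word_mul s t) w.
Proof.
by move=> rw; elim: s => //= l s ->; rewrite word_mul_push.
Qed.

Lemma word_mulV s w : reduced_word w -> word_mul (word_inv s) (word_mul s w) = w.
Proof.
move=> rw; elim: s => //= l s IHs.
rewrite /word_inv /= rev_cons /word_mul foldr_rcons -/(word_mul s w).
by rewrite push_inv ?reduced_word_mul.
Qed.

Definition free_group_one := @FreeGroup [::] isT.
Definition free_group_mul (a b : free_group) :=
  FreeGroup (reduced_word_mul a (free_group_reduced b)).
Definition free_group_inv (a : free_group) :=
  FreeGroup (reduced_word_inv (free_group_reduced a)).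

Fact free_group_mulA : associative free_group_mul.
Proof. by move=> a b c; apply/val_inj/word_mulA/free_group_reduced. Qed.

Fact free_group_mul1 : left_id free_group_one free_group_mul.
Proof. by move=> a; apply/val_inj. Qed.

Fact free_group_mulr1 : right_id free_group_one free_group_mul.
Proof. by move=> a; apply/val_inj/word_mul0/free_group_reduced. Qed.

Fact free_group_mulV :
  left_inverse free_group_one free_group_inv free_group_mul.
Proof.
move=> a; apply/val_inj => /=; rewrite -{2}[val a]word_mul0 ?word_mulV//.
exact: free_group_reduced.
Qed.

Fact free_group_mulrV :
  right_inverse free_group_one free_group_inv free_group_mul.
Proof.
move=> a; rewrite -[LHS]free_group_mul1.
rewrite -{1}(free_group_mulV (free_group_inv a)) -free_group_mulA.
by rewrite [X in free_group_mul _ X]free_group_mulA free_group_mulV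
  free_group_mul1 free_group_mulV.
Qed.

HB.instance Definition _ := isGroup.Build free_group
  free_group_mulA free_group_mul1 free_group_mulr1
  free_group_mulV free_group_mulrV.

End FreeGroup.

Record normal_subgroup (G : groupType) (N : set G) : Prop := NormalSubgroup {
  normal_subgroup1 : N 1%g;
  normal_subgroupM : forall a b, N a -> N b -> N (a * b)%g;
  normal_subgroupV : forall a, N a -> N a^-1%g;
  normal_subgroupJ : forall a g, N a -> N (a ^ g)%g }.

Definition normal_closure (G : groupType) (S : set G) : set G :=
  \bigcap_(N in [set N | normal_subgroup N /\ S `<=` N]) N.

(* G is isomorphic to < X | r_0, ..., r_(n-1) >; the set of generators may be
   infinite. *)
Definition n_relator_group (n : nat) (G : groupType) : Prop :=
  exists (X : choiceType) (r : 'I_n -> free_group X)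
         (f : {multiplicative free_group X -> G}),
    range f = [set: G] /\ f @^-1` [set 1%g] = normal_closure (range r).

Definition gromov_product (R : realType) (H : metricType R) (p q r : H) : R :=
  (mdist p r + mdist q r - mdist p q) / 2.

(* c is an arc length parametrization of a geodesic [p, q] starting at p; its
   values outside `[0, |p - q|] are irrelevant. *)
Definition is_geodesic (R : realType) (H : metricType R) (p q : H)
    (c : R -> H) : Prop :=
  [/\ c 0 = p, c (mdist p q) = q &
      {in `[0, mdist p q] &, forall s t, mdist (c s) (c t) = `|s - t|}].

Record hyperbolic_space (R : realType) (delta : R) (H : metricType R) : Prop :=
  HyperbolicSpace {
    hyperbolic_ge0 : 0 <= delta;
    hyperbolic_nonempty : [set: H] !=set0;
    hyperbolic_geodesic : forall p q : H, exists c, is_geodesic p q c;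
    hyperbolic_gromov : forall p q r s : H,
      Num.min (gromov_product p s r) (gromov_product s q r) - delta
        <= gromov_product p q r;
    hyperbolic_thin : forall (r p q : H) (cp cq : R -> H),
      is_geodesic r p cp -> is_geodesic r q cq ->
      forall t, 0 <= t <= gromov_product p q r ->
        mdist (cp t) (cq t) <= delta }.

Record isometric_action (R : realType) (G : groupType) (H : metricType R)
    (act : G -> H -> H) : Prop := IsometricAction {
  isometric_action1 : forall p, act 1%g p = p;
  isometric_actionM : forall g h p, act (g * h)%g p = act g (act h p);
  isometric_action_dist : forall g p q,
    mdist (act g p) (act g q) = mdist p q }.

(* This is +oo when G is trivial. *)
Definition minimal_displacement (R : realType) (G : groupType)
    (H : metricType R) (act : G -> H -> H) : \bar R :=
  ereal_inf [set (mdist (act gp.1 gp.2) gp.2)%:E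
            | gp in [set gp : G * H | gp.1 <> 1%g]].

Definition log2 (R : realType) (x : R) : R := ln x / ln 2.

Definition group_ring (G : groupType) := {malg int[G]}.

Section GroupRing.
Variable G : groupType.
Implicit Types (a b c : group_ring G).

HB.instance Definition _ := GRing.Zmodule.on (group_ring G).

Definition group_ring_one : group_ring G := << 1%g >>.

Definition group_ring_mul a b : group_ring G :=
  \sum_(g <- msupp a) \sum_(h <- msupp b) << a@_g * b@_h *g (g * h)%g >>.

Lemma group_ring_mulw (d1 d2 : {fset G}) a b :
  (msupp a `<=` d1)%fset -> (msupp b `<=` d2)%fset ->
  group_ring_mul a b =
    \sum_(g <- d1) \sum_(h <- d2) << a@_g * b@_h *g (g * h)%g >>.
Proof.
move=> le_d1 le_d2; rewrite /group_ring_mul (big_fset_incl _ le_d1) /=.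
  apply/eq_bigr=> k1 _; apply/big_fset_incl => // k _ /mcoeff_outdom ->.
  by rewrite mulr0 monalgU0.
move=> k _ /mcoeff_outdom ak.
by rewrite big1 => // k' _; rewrite ak mul0r monalgU0.
Qed.

Lemma group_ring_mulUU (x y : int) (g h : G) :
  group_ring_mul << x *g g >> << y *g h >> = << x * y *g (g * h)%g >>.
Proof.
by rewrite (group_ring_mulw msuppU_le msuppU_le) !big_seq_fset1 !mcoeffUU.
Qed.

Lemma group_ring_mulDl : left_distributive group_ring_mul +%R.
Proof.
move=> a b c.
rewrite (group_ring_mulw (msuppD_le a b) (fsubset_refl (msupp c))).
rewrite (group_ring_mulw (fsubsetUl _ (msupp b)) (fsubset_refl (msupp c))).
rewrite (group_ring_mulw (fsubsetUr (msupp a) _) (fsubset_refl (msupp c))).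
rewrite -big_split /=; apply/eq_bigr=> k1 _.
rewrite -big_split /=; apply/eq_bigr=> k2 _.
by rewrite mcoeffD mulrDl monalgUD.
Qed.

Lemma group_ring_mulDr : right_distributive group_ring_mul +%R.
Proof.
move=> c a b.
rewrite (group_ring_mulw (fsubset_refl (msupp c)) (msuppD_le a b)).
rewrite (group_ring_mulw (fsubset_refl (msupp c)) (fsubsetUl _ (msupp b))).
rewrite (group_ring_mulw (fsubset_refl (msupp c)) (fsubsetUr (msupp a) _)).
rewrite -big_split /=; apply/eq_bigr=> k1 _.
rewrite -big_split /=; apply/eq_bigr=> k2 _.
by rewrite mcoeffD mulrDr monalgUD.
Qed.

Lemma group_ring_mul0r : left_zero 0 group_ring_mul.
Proof. by move=> a; rewrite /group_ring_mul msupp0 big_seq_fset0. Qed.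

Lemma group_ring_mulr0 : right_zero 0 group_ring_mul.
Proof.
by move=> a; rewrite /group_ring_mul exchange_big msupp0 big_seq_fset0.
Qed.

Lemma group_ring_suml (I : Type) (r : seq I) (F : I -> group_ring G) b :
  group_ring_mul (\sum_(i <- r) F i) b = \sum_(i <- r) group_ring_mul (F i) b.
Proof.
exact: (big_morph (group_ring_mul^~ b)
  (fun _ _ => group_ring_mulDl _ _ _) (group_ring_mul0r _)).
Qed.

Lemma group_ring_sumr (I : Type) (r : seq I) (F : I -> group_ring G) a :
  group_ring_mul a (\sum_(i <- r) F i) = \sum_(i <- r) group_ring_mul a (F i).
Proof.
exact: (big_morph (group_ring_mul a)
  (fun _ _ => group_ring_mulDr _ _ _) (group_ring_mulr0 _)).
Qed.

Lemma group_ringE a :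
  a = \sum_(g <- msupp a) (<< a@_g *g g >> : group_ring G) :> group_ring G.
Proof. exact: monalgE. Qed.

Fact group_ring_mulA : associative group_ring_mul.
Proof.
move=> a b c.
rewrite (group_ringE a) 3!group_ring_suml; apply/eq_bigr => g _.
rewrite (group_ringE b) group_ring_suml 2!group_ring_sumr group_ring_suml.
apply/eq_bigr => h _.
rewrite (group_ringE c) 3!group_ring_sumr; apply/eq_bigr => k _.
by rewrite !group_ring_mulUU mulrA mulgA.
Qed.

Fact group_ring_mul1r : left_id group_ring_one group_ring_mul.
Proof.
move=> a; rewrite {1}(group_ringE a) group_ring_sumr [RHS]group_ringE.
by apply/eq_bigr => g _; rewrite group_ring_mulUU mul1r mul1g.
Qed.

Fact group_ring_mulr1 : right_id group_ring_one group_ring_mul.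
Proof.
move=> a; rewrite {1}(group_ringE a) group_ring_suml [RHS]group_ringE.
by apply/eq_bigr => g _; rewrite group_ring_mulUU mulr1 mulg1.
Qed.

Fact group_ring_oner_neq0 : group_ring_one != 0.
Proof. by rewrite monalgU_eq0 oner_eq0. Qed.

HB.instance Definition _ := GRing.Zmodule_isNzRing.Build (group_ring G)
  group_ring_mulA group_ring_mul1r group_ring_mulr1
  group_ring_mulDl group_ring_mulDr group_ring_oner_neq0.

Definition augmentation a : int := \sum_(g <- msupp a) a@_g.

Lemma augmentationw (d : {fset G}) a :
  (msupp a `<=` d)%fset -> augmentation a = \sum_(g <- d) a@_g.
Proof.
by move=> le_d; rewrite /augmentation (big_fset_incl _ le_d)//= => g _
  /mcoeff_outdom.
Qed.

Lemma augmentationD : {morph augmentation : a b / a + b}.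
Proof.
move=> a b; rewrite (augmentationw (msuppD_le a b)).
rewrite (augmentationw (fsubsetUl _ (msupp b))).
rewrite (augmentationw (fsubsetUr (msupp a) _)).
by rewrite -big_split; apply/eq_bigr => g _ /=; rewrite mcoeffD.
Qed.

Lemma augmentation0 : augmentation 0 = 0.
Proof. by rewrite /augmentation msupp0 big_seq_fset0. Qed.

Lemma augmentationU (x : int) (g : G) : augmentation << x *g g >> = x.
Proof. by rewrite (augmentationw msuppU_le) big_seq_fset1 mcoeffUU. Qed.

Lemma augmentationM : {morph augmentation : a b / a * b}.
Proof.
move=> a b; rewrite [a * b]/(group_ring_mul a b) /group_ring_mul.
rewrite (big_morph _ augmentationD augmentation0) mulr_suml.
apply/eq_bigr => g _.
rewrite (big_morph _ augmentationD augmentation0) mulr_sumr.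
by apply/eq_bigr => h _; rewrite augmentationU.
Qed.

Lemma augmentation1 : augmentation 1 = 1.
Proof. exact: augmentationU. Qed.

End GroupRing.

(* Z as a module over Z[G], with G acting trivially. *)
Definition trivial_module (G : groupType) := int.

Section TrivialModule.
Variable G : groupType.

HB.instance Definition _ := GRing.Zmodule.on (trivial_module G).

Definition trivial_scale (a : group_ring G) (m : trivial_module G) :
  trivial_module G := (augmentation a * m : int).

Fact trivial_scaleA a b m :
  trivial_scale a (trivial_scale b m) = trivial_scale (a * b) m.
Proof. by rewrite /trivial_scale augmentationM mulrA. Qed.

Fact trivial_scale1 : left_id 1 trivial_scale.
Proof. by move=> m; rewrite /trivial_scale augmentation1 mul1r. Qed.

Fact trivial_scaleDr : right_distributive trivial_scale +%R.
Proof. by move=> a m p; rewrite /trivial_scale mulrDr. Qed.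

Fact trivial_scaleDl m : {morph trivial_scale^~ m : a b / a + b}.
Proof. by move=> a b; rewrite /trivial_scale augmentationD mulrDl. Qed.

HB.instance Definition _ := GRing.Zmodule_isLmodule.Build (group_ring G)
  (trivial_module G) trivial_scaleA trivial_scale1
  trivial_scaleDr trivial_scaleDl.

End TrivialModule.

(* M is isomorphic to the direct sum of copies of A indexed by some X. *)
Definition free_module (A : nzRingType) (M : lmodType A) : Prop :=
  exists (X : choiceType) (f : {linear {malg A[X]} -> M}), bijective f.

(* 0 -> F_k -> ... -> F_1 -> F_0 -> M -> 0, continued by F_i = 0 for i > k. *)
Record free_resolution (A : nzRingType) (M : lmodType A) (k : nat)
    (F : nat -> lmodType A) (d : forall i, {linear F i.+1 -> F i})
    (e : {linear F 0%N -> M}) : Prop := FreeResolution {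
  resolution_free : forall i, free_module (F i);
  resolution_aug : range e = [set: M];
  resolution_exact0 : range (d 0%N) = e @^-1` [set 0];
  resolution_exact : forall i, range (d i.+1) = d i @^-1` [set 0];
  resolution_length : forall i, (k < i)%N -> forall x : F i, x = 0 }.

(* The minimal length of a free resolution of the trivial module Z over Z[G]
   exists and is at most m. *)
Definition cohomological_dimension_le (G : groupType) (m : nat) : Prop :=
  exists k, (k <= m)%N /\
    exists (F : nat -> lmodType (group_ring G))
           (d : forall i, {linear F i.+1 -> F i})
           (e : {linear F 0%N -> trivial_module G}),
      free_resolution k d e.

(* Main.v *)
Require Import Defs.
From HB Require Import structures.
From mathcomp Require Import all_boot all_order all_algebra.
From mathcomp Require Import finmap.
From mathcomp.multinomials Require Import monalg.
From mathcomp Require Import all_classical all_reals all_analysis.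
From mathcomp Require Import zify ring lra.

Set Implicit Arguments.
Unset Strict Implicit.
Unset Printing Implicit Defensive.

Import Order.TTheory GRing.Theory Num.Theory.
Local Open Scope ring_scope.

(** Let A = Z[G] with G = < X | r_1, ..., r_n >. Fox calculus gives an exact
    sequence A^n -> A^X -> A -> Z -> 0, in which the i-th basis vector of A^n
    goes to the Fox derivative of r_i (fox_exact, augmentation_exact). Let K be
    the kernel of A^n -> A^X and M its image. If K is a direct summand of A^n,
    then M is projective, and an Eilenberg swindle replaces M by a free module
    at the cost of adding a free summand to A^X; this gives a free resolution
    of length 2 (resolution_of_projection).

    The quotient A^X / M embeds in A, so that M is pure as an abelian group.
    Hence an A-linear projection of A^n onto K can be put together from
    projections over the rationals and modulo every prime p
    (kernel_projection).

    Over these fields the projection comes from a Euclidean algorithm, an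
    analogue of the weak algorithm of P. M. Cohn for group rings of free
    groups. Map supports of elements of A^X to the hyperbolic space H by an
    orbit map. Given a nontrivial relation sum_i v_i r_i = 0 among nonzero
    elements, some r_i can be replaced by a combination of the r_j, with
    coefficient a unit at r_i, whose support has a diameter smaller by 1
    (reduction). When there is no such relation any more, the nonzero r_i are
    independent and the projection is evident (splits_mod_act).

    The new element is a part of the sum. The relation is a sum of translates
    of the r_i. Among these take a cluster: those linked to a translate that
    reaches farthest from a base point, through overlaps at points that are
    almost as far. All such points cancel in the sum over the cluster, and
    hyperbolicity bounds the diameter of what is left by that of the largest
    member of the cluster, minus 1 (exists_cluster). Two translates of the same
    r_i in a cluster, if nearly as large as its largest member, have centres
    close to each other, and coincide because the displacement is large. Hence
    the largest member is the only translate of its r_i, and the replacement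
    is an invertible change of generators.

    The four-point inequality loses log2 k along a chain of k points. Only
    O(n) of the translates in a chain count, because smaller ones lose less
    than their size gains (overlap_product), and at most n depths have to be
    tried, because each failure adds a large translate with a new index. The
    total, of order n log2 n, is less than 100 log2 ((n + 1)!)
    (displacement_bound). *)

(** * Paths in finite graphs *)

Section Restrict.
Variables (T : finType) (e : rel T).

Definition subrel_on (P : pred T) : rel T := [rel x y | [&& P x, P y & e x y]].

Lemma connect_subrel_on (P : pred T) x y : connect e x y ->
  (forall z, connect e x z -> P z) -> connect (subrel_on P) x y.
Proof.
move=> /connectP[p ep ->] xP; apply/connectP; exists p => //.
elim: p x ep xP => //= z p IH x /andP[xz zp] xP.
rewrite /subrel_on/= !xP ?connect0 ?connect1//= xz/=; apply: IH => // w zw.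
by apply: xP; apply: connect_trans zw; apply: connect1.
Qed.

(** Cut a path from x to y at its first point in P. *)
Lemma connect_enter (P Q : pred T) x y :
  connect e x y -> ~~ P x -> P y ->
  (forall z, connect e x z -> ~~ P z -> Q z) ->
  exists u v, [/\ connect (subrel_on Q) x u, e u v, ~~ P u & P v].
Proof.
move=> /connectP[p ep ->]; elim: p x ep => [|z p IH] x /=.
  by move=> _ /negPf ->.
move=> /andP[xz zp] xP pP PQ; have [Pz|Pz] := boolP (P z).
  by exists x, z; rewrite connect0.
have zQ w : connect e z w -> ~~ P w -> Q w.
  by move=> zw; apply: PQ; apply: connect_trans zw; apply: connect1.
have [u [v [zu uv Pu Pv]]] := IH z zp Pz pP zQ.
exists u, v; split=> //; apply: connect_trans zu.
by apply: connect1; rewrite /subrel_on/= PQ ?connect0//= zQ ?connect0.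
Qed.

End Restrict.

(** * Gromov products *)

(** Twice the largest depth n * (2 * l + 9) used for clusters, plus what the
    comparison of centres loses. *)
Definition separation (R : realType) (n l : nat) : R :=
  4 * l%:R + 17 + n%:R * (4 * l%:R + 18).

Section FourPoint.
Variables (R : realType) (H : metricType R).
Hypothesis four_point : forall p q r s : H,
  Num.min (gromov_product p s r) (gromov_product s q r) - 1
    <= gromov_product p q r.
Implicit Types (s t : H).

Lemma gromov_product_le_trans (z : R) (o p s q : H) :
  z <= gromov_product p s o -> z <= gromov_product s q o ->
  z - 1 <= gromov_product p q o.
Proof.
move=> zps zsq; apply: le_trans (four_point p q o s).
by rewrite lerB// le_min zps.
Qed.

Fixpoint gromov_chain (z : R) (o : H) k s t : Prop :=
  if k is k'.+1 then exists2 u, z <= gromov_product s u o & gromov_chain z o k' u t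
  else s = t.

Lemma gromov_chain_split (z : R) (o : H) j k s t : gromov_chain z o (j + k) s t ->
  exists2 u, gromov_chain z o j s u & gromov_chain z o k u t.
Proof.
elim: j s => [|j IH] s /=; first by exists s.
by move=> [v sv /IH[u vu ut]]; exists u => //; exists v.
Qed.

(** Cut the chain into halves l times; each cut costs one application of the
    four-point inequality. *)
Lemma gromov_chain_le (z : R) (o : H) l k s t : (0 < k <= 2 ^ l)%N ->
  gromov_chain z o k s t -> z - l%:R <= gromov_product s t o.
Proof.
elim: l k s t => [|l IH] k s t.
  case: k => [|[|k]]//= _ [u su <-]; by rewrite subr0.
move=> /andP[k0 kl]; have [kl'|lk] := leqP k (2 ^ l).
  move=> /IH; rewrite k0 kl' => /(_ isT); apply: le_trans.
  by rewrite lerD2l lerN2 ler_nat.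
rewrite -(subnKC (ltnW lk)) => /gromov_chain_split[u su ut].
rewrite -natr1 opprD addrA.
apply: gromov_product_le_trans (IH _ _ _ _ su) (IH _ _ _ _ ut).
  by rewrite expn_gt0 leqnn.
by rewrite subn_gt0 lk leq_subLR addnn -mul2n -expnS.
Qed.

(** The product of u and v at their midpoint m is 0, so one of u, v has product
    at most 1 with w at m: the path from w through m to that end is almost
    geodesic. *)
Lemma midpoint_close (u v m w : H) : mdist m u = mdist u v / 2 ->
  mdist m v = mdist u v / 2 ->
  mdist m w <= Num.max (mdist u w) (mdist v w) - mdist u v / 2 + 2.
Proof.
move=> mu mv; have := four_point u v m w.
rewrite /gromov_product (metric_sym u m) (metric_sym v m) mu mv.
rewrite (metric_sym w m) (metric_sym w v).
rewrite lerBlDr ge_min => /orP[] h.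
  have : mdist u w <= Num.max (mdist u w) (mdist v w) by rewrite le_max lexx.
  lra.
have : mdist v w <= Num.max (mdist u w) (mdist v w) by rewrite le_max lexx orbT.
lra.
Qed.

(** * Clusters of overlapping sets *)

(** The sets S x stand for the translates of the supports of n module elements,
    idx x for the element that is translated, and m x for the translate of the
    midpoint of a diameter; m_sep is what a large displacement provides. *)
Section Overlap.
Variables (n : nat) (T : finType) (idx : T -> 'I_n) (S : T -> seq H).
Variables (d : 'I_n -> R) (m : T -> H) (o : H) (top D : R).
Hypothesis S_top : forall x s, s \in S x -> mdist s o <= top.
Hypothesis S_diam : forall x s t, s \in S x -> t \in S x ->
  mdist s t <= d (idx x).
Hypothesis m_close : forall x w B, S x != [::] ->
  (forall s, s \in S x -> mdist s w <= B) ->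
  mdist (m x) w <= B - d (idx x) / 2 + 2.
Hypothesis m_sep : forall x y, S x != [::] -> S y != [::] -> idx x = idx y ->
  mdist (m x) (m y) <= D -> x = y.
Implicit Types (x y : T) (C b : R).

Definition shallow C s := top - C <= mdist s o.

Definition overlap C : rel T :=
  [rel x y | has [pred s | shallow C s & s \in S y] (S x)].

Lemma overlapP C x y :
  reflect (exists2 s, shallow C s & s \in S x /\ s \in S y) (overlap C x y).
Proof.
apply: (iffP hasP) => [[s sx /= /andP[sC sy]]|[s sC [sx sy]]]; exists s => //=.
by rewrite sC.
Qed.

Lemma overlap_sym C : symmetric (overlap C).
Proof.
by move=> x y; apply/overlapP/overlapP => -[s sC [sx sy]]; exists s.
Qed.

Lemma gromov_product_S C x s t : s \in S x -> t \in S x ->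
  shallow C s -> shallow C t ->
  top - C - d (idx x) / 2 <= gromov_product s t o.
Proof.
move=> sx tx; rewrite /shallow /gromov_product; have := S_diam sx tx; lra.
Qed.

(** A centre is at most top - d / 2 + 2 away from o, and d / 2 + 2 away from the
    shallow points of its set: it lies almost on the geodesics from o to these
    points. Points s and t with a large product have geodesics that stay close
    up to the height of both centres. *)
Lemma same_centre C x y s t (z : R) : idx x = idx y -> s \in S x -> t \in S y ->
  shallow C s -> shallow C t -> z <= gromov_product s t o ->
  C + 8 <= D -> 2 * (top - z) - d (idx x) + 8 <= D -> x = y.
Proof.
move=> xy sx ty sC tC zst CD zD.
have x0 : S x != [::] by case: (S x) sx.
have y0 : S y != [::] by case: (S y) ty.
apply: m_sep => //.
have mxo := m_close x0 (fun s => @S_top x s).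
have myo := m_close y0 (fun s => @S_top y s).
have mxs := m_close x0 (fun t tx => S_diam tx sx).
have myt := m_close y0 (fun s sy => S_diam sy ty).
move: sC tC; rewrite /shallow -xy in myo myt * => sC tC.
have h1 : top - C + mdist (m x) o <= 2 * gromov_product (m x) s o
  + d (idx x)/2 + 2.
  by rewrite /gromov_product; lra.
have h2 : top - C <= 2 * gromov_product t (m y) o - mdist (m y) o
  + d (idx x)/2 + 2.
  by rewrite /gromov_product (metric_sym t (m y)); lra.
have hm : mdist (m x) (m y) = mdist (m x) o + mdist (m y) o
   - 2 * gromov_product (m x) (m y) o by rewrite /gromov_product; lra.
have := four_point (m x) (m y) o s.
have := four_point s (m y) o t.
rewrite !lerBlDr !ge_min => /orP[] k1 /orP[] k2; rewrite hm; lra.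
Qed.

Lemma diam_ge0 x s : s \in S x -> 0 <= d (idx x).
Proof. by move=> sx; rewrite -(mdistxx s) S_diam. Qed.

Section Chain.
Variables (l : nat) (C : R).
Hypothesis l_large : (2 * n + 3 <= 2 ^ l)%N.
Hypothesis C_ge0 : 0 <= C.
Hypothesis C_small : 4 * l%:R + 2 * C + 8 <= D.

Let below b : pred T := [pred x | d (idx x) <= b].

Section Step.
Variables (b : R) (big : pred T).
Hypothesis bigE : forall x, big x = (b - 2 * l%:R < d (idx x)).
Let z := top - C - b / 2.
Let small_rel := subrel_on (overlap C) (below (b - 2 * l%:R)).
Let e := subrel_on (overlap C) (below b).
Hypothesis small_product : forall x y s t, d (idx x) <= b - 2 * l%:R ->
  connect small_rel x y -> s \in S x -> t \in S y -> shallow C s -> shallow C t ->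
  z <= gromov_product s t o.

Let linked k s t := exists2 j, (0 < j <= k)%N & gromov_chain z o j s t.

Let linkedS k s u t : z <= gromov_product s u o -> linked k u t -> linked k.+1 s t.
Proof. by move=> zsu [j /andP[_ jk] ut]; exists j.+1; rewrite //=; exists u. Qed.

Let linked1 k s t : z <= gromov_product s t o -> linked k.+1 s t.
Proof. by move=> zst; exists 1%N => //=; exists t. Qed.

Let linked_le k k' s t : (k <= k')%N -> linked k s t -> linked k' s t.
Proof.
move=> kk' [j /andP[j0 jk] st]; exists j => //.
by rewrite j0 (leq_trans jk).
Qed.

(** The points of consecutive overlaps form a chain. A run of small sets counts
    as one link of it, by small_product, so that the length of the chain is
    controlled by the number of big sets alone. *)
Let path_linked p x t : d (idx x) <= b -> path e x p -> t \in S (last x p) -> shallow C t ->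
  (big x -> forall s, s \in S x -> shallow C s ->
     linked (2 * count big (x :: p)) s t) /\
  (~~ big x -> forall y, d (idx y) <= b - 2 * l%:R -> connect small_rel y x ->
     forall s, s \in S y -> shallow C s ->
     linked (2 * count big (x :: p)).+1 s t).
Proof.
have bigN y : ~~ big y -> d (idx y) <= b - 2 * l%:R by rewrite bigE -leNgt.
have zS y s u : s \in S y -> u \in S y -> d (idx y) <= b -> shallow C s -> shallow C u ->
    z <= gromov_product s u o.
  move=> sy uy yb sC uC; have := gromov_product_S sy uy sC uC.
  apply: le_trans; rewrite /z; lra.
elim: p x => [|y p IH] x /= xb.
  move=> _ tx tC; split=> [bx s sx sC|sx y yb yx s sy sC].
    by rewrite bx; apply: linked1; apply: zS tC => //; last exact: xb.
  by rewrite (negPf sx) /=; apply: linked1; apply: small_product yx _ _ _ _.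
move=> /andP[/and3P[_ yb /overlapP[u uC [ux uy]]] yp] tp tC.
have [IHb IHs] := IH y yb yp tp tC.
have [by_|sy] := boolP (big y).
  have {}IHb := IHb by_ u uy uC; rewrite /= by_ in IHb.
  split=> [bx s sx sC|sx w wb wx s sw sC].
    rewrite bx/=; have := linkedS (zS x s u sx ux xb sC uC) IHb.
    by apply: linked_le; clear; lia.
  rewrite (negPf sx)/=.
  have := linkedS (small_product wb wx sw ux sC uC) IHb.
  by apply: linked_le; clear; lia.
have {}IHs := IHs sy; rewrite /= (negPf sy) in IHs.
split=> [bx s sx sC|sx w wb wx s sw sC].
  rewrite bx/=.
  have := IHs y (bigN _ sy) (connect0 _ _) u uy uC.
  move=> /(linkedS (zS x s u sx ux xb sC uC)).
  by apply: linked_le; clear; lia.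
rewrite (negPf sx)/=; apply: IHs wb _ s sw sC.
apply: connect_trans wx _; apply: connect1.
by apply/and3P; split; [exact: bigN|exact: bigN|apply/overlapP; exists u].
Qed.

Let path_product p x s t : d (idx x) <= b -> path e x p ->
  s \in S x -> t \in S (last x p) -> shallow C s -> shallow C t ->
  (count big (x :: p) <= n.+1)%N -> z - l%:R <= gromov_product s t o.
Proof.
move=> xb xp sx tp sC tC xpn.
have [hb hs] := path_linked xb xp tp tC.
have [j jn st] : linked (2 * count big (x :: p)).+1 s t.
  have [bx|Nbx] := boolP (big x).
    by have := hb bx s sx sC; apply: linked_le; clear; lia.
  apply: hs (connect0 _ _) s sx sC => //.
  by rewrite leNgt -bigE.
apply: (gromov_chain_le _ st).
move: jn xpn l_large; clear; lia.
Qed.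

(** By induction the tail has at most n big sets. If x had the index of a big
    set w of the tail, the path from x to w would have at most n + 1 of them;
    then path_product and same_centre give x = w. *)
Let path_big_uniq p x : d (idx x) <= b -> path e x p -> uniq (x :: p) ->
  uniq (map idx (seq.filter big (x :: p))).
Proof.
elim: p x => [|y p IH] x; first by move=> _ _ _ /=; case: ifP.
move=> xb xyp; have := xyp; rewrite [path _ _ _]/= => /andP[/and3P[_ yb xy] yp].
move=> xyp_uniq.
have yp_uniq : uniq (y :: p) by move: xyp_uniq => /= /andP[].
have {}IH := IH y yb yp yp_uniq.
have -> : seq.filter big (x :: y :: p) =
  if big x then x :: seq.filter big (y :: p) else seq.filter big (y :: p) by [].
case: ifP => // bx.
rewrite map_cons cons_uniq IH andbT; apply/mapP => -[w].
rewrite mem_filter => /andP[bw wyp] xw.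
have [p1 [p2 yp_eq]] : exists p1 p2, y :: p = p1 ++ w :: p2.
  by case/splitPr: wyp => p1 p2; exists p1, p2.
have big_le : (count big (y :: p) <= n)%N.
  rewrite -size_filter -(size_map idx) -(card_uniqP IH).
  by rewrite -[X in (_ <= X)%N](card_ord n) max_card.
have cnt : (count big (x :: rcons p1 w) <= n.+1)%N.
  move: big_le; rewrite yp_eq /= -cats1 !count_cat/= bx; clear; lia.
move: xyp xyp_uniq; rewrite yp_eq cat_path => /andP[xp1].
move=> /= /andP[/and3P[p1b wb /overlapP[t tC [tp1 tw]]] _] xyp_uniq.
have [s sC [sx _]] := overlapP _ _ _ xy.
suff xw' : x = w by move: xyp_uniq; rewrite -xw' mem_cat inE eqxx orbT.
have xp1w : path e x (rcons p1 w).
  by rewrite rcons_path xp1; apply/and4P; split; [by []|exact: p1b|exact: wb|apply/overlapP; exists t].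
apply: (same_centre xw sx tw sC tC (path_product xb xp1w sx _ sC tC cnt)).
- by rewrite last_rcons.
- by move: C_ge0 C_small (ler0n R l); lra.
- by move: bx C_small; rewrite bigE /z; lra.
Qed.

Lemma overlap_product_step x y s t : d (idx x) <= b -> connect e x y ->
  s \in S x -> t \in S y -> shallow C s -> shallow C t ->
  z - l%:R <= gromov_product s t o.
Proof.
move=> xb /connectP[p0 ep0 ->]; case/shortenP: ep0 => p ep p_uniq _ sx tp sC tC.
apply: (path_product xb ep sx tp sC tC).
rewrite -size_filter -(size_map idx) -(card_uniqP (path_big_uniq xb ep p_uniq)).
by rewrite (leq_trans (max_card _))// card_ord.
Qed.
End Step.

(** Induction on b in steps of 2 * l. Small sets, those with d <= b - 2 * l, lose
    l by the induction hypothesis and gain as much from the smaller diameter;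
    hence a run of small sets is as good as a single overlap. Big sets have
    distinct indices on a simple path, so that chains have at most 2 * n + 1
    links, whatever the number of sets. *)
Lemma overlap_product b x y s t : d (idx x) <= b ->
  connect (subrel_on (overlap C) (below b)) x y ->
  s \in S x -> t \in S y -> shallow C s -> shallow C t ->
  top - C - b / 2 - l%:R <= gromov_product s t o.
Proof.
have l1 : (1 : R) <= l%:R.
  by move: l_large; rewrite ler1n; case: (l) => //=; clear; lia.
have [k] : exists k : nat, b < k%:R.
  by exists (Num.bound `|b|); rewrite (le_lt_trans (ler_norm _))// archi_boundP.
elim: k b x y s t => [|k IH] b x y s t bk xb xy sx ty sC tC.
  by have := diam_ge0 sx; rewrite leNgt (le_lt_trans xb).
apply: (@overlap_product_step b [pred x | b - 2 * l%:R < d (idx x)] _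
  _ x y s t xb xy sx ty sC tC) => //.
move=> {x y s t xb xy sx ty sC tC} x y s t xb xy sx ty sC tC.
have bk' : b - 2 * l%:R < k%:R by move: bk; rewrite -natr1; lra.
have := IH _ x y s t bk' xb xy sx ty sC tC; lra.
Qed.
End Chain.

Section Stages.
Variables (l : nat) (x0 : T) (q : H).
Hypothesis l_large : (2 * n + 3 <= 2 ^ l)%N.
Hypothesis D_large : separation R n l <= D.
Hypothesis qx0 : q \in S x0.
Hypothesis q_top : mdist q o = top.

(** The gain in depth that pays for the loss l and for four applications of the
    four-point inequality, all counted twice, and leaves 1. *)
Definition step : R := 2 * l%:R + 9.
Definition depth (j : nat) : R := j%:R * step.
Let component j : pred T := connect (overlap (depth j)) x0.

Let step_gt0 : 0 < step.
Proof. by rewrite /step; have := ler0n R l; lra. Qed.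

Let depth_ge0 j : 0 <= depth j.
Proof. by rewrite /depth mulr_ge0// ltW. Qed.

Let depth_small j : (j <= n)%N -> 2 * depth j + 4 * l%:R + 17 <= D.
Proof.
move=> jn; apply: le_trans D_large; rewrite /separation.
have : depth j <= n%:R * step by rewrite /depth ler_pM2r// ler_nat.
by rewrite /step; lra.
Qed.

Let depthS j : depth j.+1 = depth j + step.
Proof. by rewrite /depth -natr1 mulrDl mul1r. Qed.

Let overlap_le C C' x y : C <= C' -> overlap C x y -> overlap C' x y.
Proof.
move=> CC' /overlapP[s sC sxy]; apply/overlapP; exists s => //.
by move: sC; rewrite /shallow; lra.
Qed.

Let component_le i j x : (i <= j)%N -> component i x -> component j x.
Proof.
move=> ij; apply: connect_sub => y z yz; apply: connect1.
by apply: overlap_le yz; rewrite /depth ler_pM2r// ler_nat.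
Qed.

Let component_sym j x y : component j x -> component j y ->
  connect (overlap (depth j)) x y.
Proof.
move=> jx; apply: connect_trans.
by rewrite (sym_connect_sym (@overlap_sym _)).
Qed.

Let component_shallow j x : component j x -> exists2 s, s \in S x & shallow (depth j) s.
Proof.
move=> /connectP[p]; case/lastP: p => [|p y] /=.
  move=> _ ->; exists q => //; rewrite /shallow q_top; have := depth_ge0 j; lra.
rewrite rcons_path last_rcons => /andP[_ /overlapP[s sj [_ sy]]] ->.
by exists s.
Qed.

Let component_product j b x y s t : (j <= n)%N ->
  component j x -> component j y -> (forall z, component j z -> d (idx z) <= b) ->
  s \in S x -> t \in S y -> shallow (depth j) s -> shallow (depth j) t ->
  top - depth j - b / 2 - l%:R <= gromov_product s t o.
Proof.
move=> jn jx jy jb.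
have small : 4 * l%:R + 2 * depth j + 8 <= D by have := depth_small jn; lra.
apply: (overlap_product l_large (depth_ge0 j) small (jb _ jx)).
apply: connect_subrel_on; first exact: component_sym.
by move=> z xz; apply: jb; apply: connect_trans xz.
Qed.

(** Sets of nearly maximal diameter in a component are determined by their
    indices: the product of their shallow points is almost the height of their
    centres. *)
Let component_inj j b x y : (j <= n)%N ->
  component j x -> component j y -> (forall z, component j z -> d (idx z) <= b) ->
  b <= d (idx x) + step -> idx x = idx y -> x = y.
Proof.
move=> jn jx jy jb bx xy.
have [s sx sj] := component_shallow jx; have [t ty tj] := component_shallow jy.
have st := component_product jn jx jy jb sx ty sj tj.
have := depth_small jn; have := depth_ge0 j; have := ler0n R l => l0 C0 CD.
apply: (same_centre xy sx ty sj tj st).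
  by lra.
by move: bx CD; rewrite /step; lra.
Qed.

Let settled j := [forall y, (component j.+1 y && ~~ component j y) ==>
  [exists x, component j.+1 x && (d (idx y) <= d (idx x) - step)]].

(** If no level is settled, each of the n levels brings in a new set w of nearly
    maximal diameter. By component_inj its index differs from those of all
    earlier ones and of x0, which makes n + 1 indices. *)
Let exists_settled : exists2 j, (j < n)%N & settled j.
Proof.
apply: contrapT => noj.
pose fresh j := [pick y | [&& component j.+1 y, ~~ component j y &
  [forall x, component j.+1 x ==> (d (idx x) < d (idx y) + step)]]].
pose w j := if j is j'.+1 then odflt x0 (fresh j') else x0.
have wP j : (j < n)%N -> [/\ component j.+1 (w j.+1), ~~ component j (w j.+1) &
    forall x, component j.+1 x -> d (idx x) < d (idx (w j.+1)) + step].
  move=> jn; have : ~~ settled j by apply/negP => sj; apply: noj; exists j.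
  rewrite negb_forall => /existsP[y]; rewrite negb_imply negb_exists.
  move=> /andP[/andP[jy Njy] /forallP yx].
  rewrite /w /fresh; case: pickP => /= [v /and3P[jv Njv /forallP vx]|/(_ y)].
    by split=> // x; apply/implyP.
  rewrite jy Njy /= => /forallP[x]; apply/implyP => jx.
  by have := yx x; rewrite jx /= -ltNge; lra.
have w_comp j : (j <= n)%N -> component j (w j).
  by case: j => [_|j /wP[]//]; exact: connect0.
have w_neq i j : (i < j <= n)%N -> idx (w i) <> idx (w j).
  move=> /andP[ij jn] wij.
  case: j ij jn wij => // j ij jn wij.
  have [jw Njw wx] := wP j jn.
  suff wijE : w j.+1 = w i.
    by move: Njw; rewrite wijE (component_le _ (w_comp i _))//; lia.
  apply: (component_inj jn jw (component_le _ (w_comp i _))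
    (fun x jx => ltW (wx x jx))) => //; lia.
have : injective (fun i : 'I_n.+1 => idx (w i)).
  move=> i j /= wij; apply/val_inj; case: (ltngtP i j) => //= ij.
    by case: (@w_neq i j); rewrite // ij -ltnS ltn_ord.
  by case: (@w_neq j i); rewrite // ij -ltnS ltn_ord.
by move=> /leq_card; rewrite !card_ord ltnn.
Qed.

(** K is the component of x0 at a settled level j + 1. A point that K shares with
    a set outside K has depth more than depth j.+1, otherwise that set would
    overlap K. Two such points s, t are joined by a chain through points of
    depth at most depth j (anchor), which lie in the component at level j,
    where overlap_product applies. The distance of s and t is the sum of their
    heights minus twice their product: being one step deeper than the chain
    makes it smaller than the diameter of the largest set. *)
Lemma exists_cluster : exists (K : pred T) x1,
  [/\ K x1, S x1 != [::], forall y, K y -> idx y = idx x1 -> y = x1 &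
   forall x x' y y' s t, K x -> K x' -> ~~ K y -> ~~ K y' ->
     s \in S x -> s \in S y -> t \in S x' -> t \in S y' ->
     mdist s t <= d (idx x1) - 1].
Proof.
have [j jn /forallP settled_j] := exists_settled.
have jn' := ltnW jn.
have : exists2 x1, component j.+1 x1 &
    forall x, component j.+1 x -> d (idx x) <= d (idx x1).
  have := @arg_maxP _ R T x0 (component j.+1) (fun x => d (idx x)) (connect0 _ _).
  by case=> x1 jx1 x1P; exists x1.
move=> [x1 jx1 x1P].
have [s1 s1x1 _] := component_shallow jx1.
exists (component j.+1), x1; split=> //.
- by case: (S x1) s1x1.
- move=> y jy yx1; apply/esym; apply: (component_inj jn jx1 jy x1P _ (esym yx1)).
  by rewrite lerDl ltW.
have old_le x : component j x -> d (idx x) <= d (idx x1).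
  by move=> jx; apply: x1P; apply: component_le jx.
have deep x y s : component j.+1 x -> ~~ component j.+1 y ->
    s \in S x -> s \in S y -> mdist s o < top - depth j.+1.
  move=> jx jy sx sy; rewrite ltNge; apply: contra jy => sj.
  apply: connect_trans jx _; apply: connect1; apply/overlapP.
  by exists s.
(* z1 s bounds the product of s with a point of depth at most depth j in a set
   of diameter d (idx x1); z2 is left by a chain of sets that are new at level
   j + 1, hence smaller by a step. *)
pose z1 s := (mdist s o + top - depth j - d (idx x1)) / 2.
pose z2 := top - depth j.+1 - (d (idx x1) - step) / 2 - l%:R.
have anchor x s (z : R) : component j.+1 x -> s \in S x -> z <= z1 s -> z <= z2 ->
    exists x' s', [/\ component j x', s' \in S x', shallow (depth j) s' &
      z - 2 <= gromov_product s s' o].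
  move=> jx sx zz1 zz2.
  have [ojx|njx] := boolP (component j x).
    have [u ux uj] := component_shallow ojx; exists x, u; split=> //.
    have := S_diam sx ux; have := old_le x ojx.
    by move: uj zz1; rewrite /shallow /z1 /gromov_product; lra.
  have new_le y : component j.+1 y -> ~~ component j y ->
      d (idx y) <= d (idx x1) - step.
    move=> jy njy; have := settled_j y; rewrite jy njy => /existsP[y' /andP[jy' yy']].
    by have := x1P _ jy'; lra.
  have [v [w [xv vw njv jw]]] := @connect_enter _ _ (component j)
    [pred y | d (idx y) <= d (idx x1) - step] x x0
    (component_sym jx (connect0 _ _)) njx (connect0 _ _)
    (fun y xy => new_le y (connect_trans jx xy)).
  have [u ux uj] := component_shallow jx.
  move/overlapP: (vw) => [t tj [tv tw]].
  have [s' s'w s'j] := component_shallow jw.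
  exists w, s'; split=> //.
  have su : z <= gromov_product s u o.
    have := S_diam sx ux; have := new_le x jx njx.
    by move: uj zz1; rewrite /shallow /z1 /gromov_product depthS; lra.
  have ut : z <= gromov_product u t o.
    apply: le_trans zz2 _.
    have small : 4 * l%:R + 2 * depth j.+1 + 8 <= D by have := depth_small jn; lra.
    exact: (overlap_product l_large
      (depth_ge0 j.+1) small (new_le x jx njx) xv ux tv uj tj).
  have ts' : z <= gromov_product t s' o.
    have := S_diam tw s'w; have := old_le w jw; have := ler0n R l.
    by move: tj s'j zz2; rewrite /shallow /z2 /gromov_product depthS; lra.
  have st := gromov_product_le_trans su ut.
  have := gromov_product_le_trans st (_ : z - 1 <= gromov_product t s' o).
  by rewrite -addrA -opprD -[1 + 1]/2; apply; lra.
move=> x x' y y' s t jx jx' jy jy' sx sy tx' ty'.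
have sd := deep _ _ _ jx jy sx sy; have td := deep _ _ _ jx' jy' tx' ty'.
pose z := Num.min (Num.min (z1 s) (z1 t)) z2.
have zs : z <= z1 s by rewrite /z !ge_min lexx.
have zt : z <= z1 t by rewrite /z !ge_min lexx orbT.
have zz2 : z <= z2 by rewrite /z !ge_min lexx !orbT.
have [w [s' [jw s'w s'j ss']]] := anchor x s z jx sx zs zz2.
have [w' [t' [jw' t'w' t'j tt']]] := anchor x' t z jx' tx' zt zz2.
have s't' := component_product jn' jw jw' old_le s'w t'w' s'j t'j.
have l0 := ler0n R l.
have s't : z - 3 <= gromov_product s' t o.
  have -> : z - 3 = z - 2 - 1 by lra.
  apply: (gromov_product_le_trans (s := t')).
    by move: s't' zz2; rewrite /z2 depthS; have := step_gt0; lra.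
  by rewrite /gromov_product (metric_sym t' t) addrC; move: tt'; rewrite /gromov_product; lra.
have st : z - 4 <= gromov_product s t o.
  have -> : z - 4 = z - 3 - 1 by lra.
  apply: (gromov_product_le_trans (s := s')) s't.
  by lra.
have : mdist s t <= mdist s o + mdist t o - 2 * z + 8.
  by move: st; rewrite /gromov_product; lra.
move: sd td; rewrite depthS => sd td.
rewrite /z /Num.min; case: ifP => _; last first.
  by rewrite /z2 depthS; move: sd td; rewrite /step; lra.
by case: ifP => _; rewrite /z1; move: sd td; rewrite /step; lra.
Qed.

End Stages.
End Overlap.
End FourPoint.

(** * From splittings modulo all primes to a splitting over the integers *)

Section LinearCombination.
Variables (A : nzRingType) (V : lmodType A) (n : nat).
Implicit Types (r : 'I_n -> V) (u v : 'rV[A]_n) (P Q : 'M[A]_n).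

Definition lincomb r v : V := \sum_i v 0 i *: r i.

Lemma lincomb_is_zmod r : zmod_morphism (lincomb r).
Proof.
move=> u v; rewrite /lincomb -sumrB; apply: eq_bigr => i _.
by rewrite !mxE scalerBl.
Qed.

HB.instance Definition _ r :=
  GRing.isZmodMorphism.Build 'rV[A]_n V (lincomb r) (lincomb_is_zmod r).

Lemma lincombN r v : lincomb r (- v) = - lincomb r v.
Proof. exact: raddfN. Qed.

Lemma lincombB r u v : lincomb r (u - v) = lincomb r u - lincomb r v.
Proof. exact: raddfB. Qed.

Lemma lincombMn r v k : lincomb r (v *+ k) = lincomb r v *+ k.
Proof. exact: raddfMn. Qed.

Lemma lincombMz r v k : lincomb r (v *~ k) = lincomb r v *~ k.
Proof. exact: raddfMz. Qed.

Lemma lincombZ r a v : lincomb r (a *: v) = a *: lincomb r v.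
Proof. by rewrite /lincomb scaler_sumr; apply: eq_bigr => i _; rewrite mxE scalerA. Qed.

Lemma lincomb_delta r i : lincomb r (delta_mx 0 i) = r i.
Proof.
rewrite /lincomb (bigD1 i)//= big1 ?addr0 => [|j ji]; rewrite mxE eqxx /=.
  by rewrite eqxx scale1r.
by rewrite (negPf ji) scale0r.
Qed.

Lemma lincomb_mul r v P : lincomb r (v *m P) = lincomb (fun i => lincomb r (row i P)) v.
Proof.
rewrite /lincomb; under eq_bigr do rewrite mxE scaler_suml.
rewrite exchange_big; apply: eq_bigr => i _; rewrite scaler_sumr.
by apply: eq_bigr => j _; rewrite scalerA mxE.
Qed.

End LinearCombination.

(** For p = 0 this is v = 0, so that p = 0 stands for the field of rationals. *)
Definition divides (V : zmodType) (p : nat) (v : V) := exists w, v = w *+ p.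

Section Divides.
Variables (V W : zmodType) (p : nat).
Implicit Types u v : V.

Lemma divides0 : divides p (0 : V).
Proof. by exists 0; rewrite mul0rn. Qed.

Lemma dividesD u v : divides p u -> divides p v -> divides p (u + v).
Proof. by move=> [a ->] [b ->]; exists (a + b); rewrite mulrnDl. Qed.

Lemma dividesN u : divides p u -> divides p (- u).
Proof. by move=> [a ->]; exists (- a); rewrite mulNrn. Qed.

Lemma dividesB u v : divides p u -> divides p v -> divides p (u - v).
Proof. by move=> pu pv; apply: dividesD => //; apply: dividesN. Qed.

Lemma divides_Mn u : divides p (u *+ p). Proof. by exists u. Qed.

Lemma divides_sum I (s : seq I) (P : pred I) (F : I -> V) :
  (forall i, P i -> divides p (F i)) -> divides p (\sum_(i <- s | P i) F i).
Proof. by move=> pF; apply: big_ind => //; [exact: divides0|exact: dividesD]. Qed.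

Lemma divides_raddf (f : {additive V -> W}) v : divides p v -> divides p (f v).
Proof. by move=> [w ->]; exists (f w); rewrite raddfMn. Qed.

Lemma divides_mulrz u z : divides p u -> divides p (u *~ z).
Proof. by move=> [w ->]; exists (w *~ z); rewrite pmulrn mulrzAC -pmulrn. Qed.
End Divides.

Definition torsion_free (V : zmodType) := forall (v : V) k, (0 < k)%N -> v *+ k = 0 -> v = 0.

Lemma torsion_free_mx (A : nzRingType) m n : torsion_free A -> torsion_free 'M[A]_(m, n).
Proof.
move=> A0 v k k0 /matrixP vk; apply/matrixP => i j; rewrite mxE.
by apply: (A0 _ k k0); have := vk i j; rewrite mulmxnE mxE.
Qed.

Section Projection.
Variables (A : nzRingType) (V : lmodType A) (n : nat) (r : 'I_n -> V).
Hypothesis A_tf : torsion_free A.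
Hypothesis V_tf : torsion_free V.
Hypothesis pure : forall w k v, (0 < k)%N -> w *+ k = lincomb r v ->
  exists u, w = lincomb r u.

Let multiple (N : nat) := exists P : 'M[A]_n,
  (forall u, lincomb r (u *m P) = 0) /\
  (forall v, lincomb r v = 0 -> v *m P = v *+ N).

(** As s is invertible modulo p, P / s is modulo p a projection onto the kernel
    of lincomb r; for p = 0, it is one over the rationals. The factor s avoids
    a change of the coefficient ring. *)
Definition splits_mod (p : nat) := exists (P : 'M[A]_n) (s : int),
  [/\ ~~ (p %| s)%Z, forall u, divides p (lincomb r (u *m P)) &
   forall v, divides p (lincomb r v) -> divides p (v *m P - v *~ s)].

Let mulmxMn (m1 m2 m3 : nat) (M : 'M[A]_(m1, m2)) (N : 'M[A]_(m2, m3)) k :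
  (M *+ k) *m N = (M *m N) *+ k.
Proof. by elim: k => [|k IH]; rewrite ?mulr0n ?mul0mx// !mulrS mulmxDl IH. Qed.

Let mulmxMnr (m1 m2 m3 : nat) (M : 'M[A]_(m1, m2)) (N : 'M[A]_(m2, m3)) k :
  M *m (N *+ k) = (M *m N) *+ k.
Proof. by elim: k => [|k IH]; rewrite ?mulr0n ?mulmx0// !mulrS mulmxDr IH. Qed.

Let mulmxMzr (m1 m2 m3 : nat) (M : 'M[A]_(m1, m2)) (N : 'M[A]_(m2, m3)) k :
  M *m (N *~ k) = (M *m N) *~ k.
Proof. exact: (raddfMz (mulmx M)). Qed.

Let multiple0 : splits_mod 0 -> exists2 N, (0 < N)%N & multiple N.
Proof.
move=> [P [s [s0 rP vP]]]; rewrite dvd0z in s0.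
exists `|s|%N; first by rewrite absz_gt0.
have d0 (W : zmodType) (w : W) : divides 0 w -> w = 0 by case=> ? ->; rewrite mulr0n.
have vPE v : lincomb r v = 0 -> v *m P = v *~ s.
  by move=> v0; apply/subr0_eq/d0/vP; rewrite v0; exact: divides0.
case: (intP s) s0 vPE => [//|k _ vPE|k _ vPE].
  by exists P; split=> [u|v v0]; [exact/d0/rP|exact: vPE].
exists (- P); split=> [u|v v0]; first by rewrite mulmxN lincombN (d0 _ _ (rP u)) oppr0.
by rewrite mulmxN vPE// mulrNz opprK abszN.
Qed.

(** By purity lincomb r (u *m P), which is divisible by p, is p times some
    lincomb r (u *m U); then P - p U maps into the kernel. Bezout turns the
    factor s into 1 modulo p. *)
Let multiple_mod p : prime p -> splits_mod p -> exists P : 'M[A]_n,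
  (forall u, lincomb r (u *m P) = 0) /\
  (forall v, lincomb r v = 0 -> divides p (v *m P - v)).
Proof.
move=> pp [P [s [ps rP vP]]]; have p0 := prime_gt0 pp.
have [U rU] : exists U : 'M[A]_n, forall u, lincomb r (u *m P) = lincomb r (u *m U) *+ p.
  have : forall i, exists u, lincomb r (row i P) = lincomb r u *+ p.
    move=> i; have [w] := rP (delta_mx 0 i).
    rewrite -rowE => wE; have [u wu] := pure p0 (esym wE).
    by exists u; rewrite wE wu.
  move=> /boolp.choice[f fP]; exists (\matrix_i f i) => u.
  rewrite !lincomb_mul /lincomb -sumrMnl; apply: eq_bigr => i _.
  rewrite -!/(lincomb _ _) rowK fP.
  by rewrite scalerMnr.
have {}rU u : lincomb r (u *m (P - U *+ p)) = 0.
  by rewrite mulmxBr lincombB rU mulmxMnr lincombMn subrr.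
have [s' ss'] : exists s' : int, (p %| s * s' - 1)%Z.
  have : coprimez s p by rewrite coprimez_sym coprimezE prime_coprime.
  move=> /coprimezP [[a b] /= ab]; exists a.
  by apply/dvdzP; exists (- b); rewrite -ab; ring.
exists ((P - U *+ p) *~ s'); split=> [u|v v0].
  by rewrite mulmxMzr lincombMz rU mul0rz.
have -> : v *m ((P - U *+ p) *~ s') - v =
   (v *m P - v *~ s) *~ s' - ((v *m U) *~ s') *+ p + v *~ (s * s' - 1).
  rewrite mulmxMzr mulmxBr mulmxMnr !mulrzBl mulrzBr mulrzA mulr1z.
  by rewrite !pmulrn mulrzAC [RHS]addrA [_ - _ - _ *~ _ *~ _ in RHS]addrAC subrK.
apply: dividesD; first apply: dividesB.
- by apply/divides_mulrz/vP; rewrite v0; exact: divides0.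
- exact: divides_Mn.
- by have /dvdzP[k ->] := ss'; exists (v *~ k); rewrite pmulrn mulrzA.
Qed.

(** PN maps into the kernel, on which P2 - 1 is divisible by p. The quotient
    M = PN (P2 - 1) / p maps into the kernel and is N (P2 - 1) on it, so that
    N P2 - M is N there. *)
Let multiple_div p N : prime p -> splits_mod p -> multiple (p * N) -> multiple N.
Proof.
move=> pp /(multiple_mod pp)[P2 [rP2 vP2]] [PN [rPN vPN]].
have p0 := prime_gt0 pp.
have [M PM] : exists M : 'M[A]_n, PN *m P2 - PN = M *+ p.
  have : forall i, exists w, row i PN *m P2 - row i PN = w *+ p.
    by move=> i; apply: vP2; rewrite rowE rPN.
  move=> /boolp.choice[f fP]; exists (\matrix_i f i); apply/row_matrixP => i.
  by rewrite raddfB/= row_mul fP raddfMn/= rowK.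
exists (P2 *+ N - M); split=> [u|v v0].
  rewrite mulmxBr lincombB mulmxMnr lincombMn rP2 mul0rn sub0r.
  apply/eqP; rewrite oppr_eq0; apply/eqP/(V_tf p0).
  by rewrite -lincombMn -mulmxMnr -PM mulmxBr lincombB rPN mulmxA rP2 subrr.
apply/subr0_eq/(torsion_free_mx A_tf p0).
rewrite mulrnBl mulmxBr mulrnBl -[(v *m M) *+ p]mulmxMnr -PM mulmxBr mulmxA.
rewrite vPN// mulmxMn mulmxMnr -!mulrnA (mulnC N p).
by rewrite opprB addrCA subrr addr0 subrr.
Qed.

(** The case p = 0 gives a map into the kernel that is multiplication by some
    N > 0 on it; the prime factors of N are then removed one at a time. *)
Lemma kernel_projection : (forall p, p = 0%N \/ prime p -> splits_mod p) ->
  exists P : 'M[A]_n, (forall u, lincomb r (u *m P) = 0) /\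
    (forall v, lincomb r v = 0 -> v *m P = v).
Proof.
move=> split_r; have [|N N0 mN] := multiple0; first by apply: split_r; left.
suff [P [rP vP]] : multiple 1 by exists P.
elim/ltn_ind: N N0 mN => N IH N0 mN.
have [N1|N1] := leqP N 1; first by have <- : N = 1%N by lia.
have pN := pdiv_prime N1.
apply: (IH (N %/ pdiv N)%N).
- by rewrite ltn_Pdiv ?prime_gt1.
- by rewrite divn_gt0 ?prime_gt0// dvdn_leq// pdiv_dvd.
- apply: (multiple_div pN); first by apply: split_r; right.
  by rewrite mulnC divnK ?pdiv_dvd.
Qed.
End Projection.

(** * Fox calculus *)

Lemma mcoeffMz (X : choiceType) (V : zmodType) x (v : {malg V[X]}) (k : int) :
  (v *~ k)@_x = v@_x *~ k.
Proof. exact: (raddfMz (mcoeff x)). Qed.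

Lemma sum_mulrzB (V : zmodType) I (s : seq I) (F : I -> V) (k : I -> int) u v :
  v = \sum_(i <- s) F i *~ k i -> \sum_(i <- s) k i = 0 ->
  \sum_(i <- s) (F i - u) *~ k i = v.
Proof.
move=> -> k0; under eq_bigr do rewrite mulrzBl.
by rewrite sumrB -mulrz_sumr k0 mulr0z subr0.
Qed.

Section FreeModule.
Variables (A : nzRingType) (X : choiceType) (M : lmodType A).

Lemma malg_genE (v : {malg A[X]}) : v = \sum_(x <- msupp v) v@_x *: << x >>.
Proof.
rewrite {1}[v]monalgE; apply: eq_bigr => x _.
by apply/malgP => y; rewrite mcoeffZ !mcoeffU mulrnAr mulr1.
Qed.

Definition malg_lift (phi : X -> M) (v : {malg A[X]}) : M :=
  \sum_(x <- msupp v) v@_x *: phi x.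

Lemma malg_liftw phi (D : {fset X}) v : (msupp v `<=` D)%fset ->
  malg_lift phi v = \sum_(x <- D) v@_x *: phi x.
Proof.
move=> vD; rewrite /malg_lift (big_fset_incl _ vD)//= => x _ /mcoeff_outdom ->.
by rewrite scale0r.
Qed.

Lemma malg_lift_is_linear phi : linear (malg_lift phi).
Proof.
move=> a u v; pose D := (msupp u `|` msupp v `|` msupp (a *: u + v))%fset.
rewrite !(@malg_liftw _ D) /D; first last.
- by rewrite fsubsetUr.
- by rewrite -fsetUA fsubsetUl.
- by rewrite (fsubset_trans (fsubsetUr (msupp u) _)) ?fsubsetUl.
rewrite scaler_sumr -big_split; apply: eq_bigr => x _ /=.
by rewrite mcoeffD mcoeffZ scalerDl scalerA.
Qed.

HB.instance Definition _ phi :=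
  GRing.isLinear.Build A {malg A[X]} M *:%R (malg_lift phi) (malg_lift_is_linear phi).

Lemma malg_liftU phi x : malg_lift phi << x >> = phi x.
Proof. by rewrite (malg_liftw _ msuppU_le) big_seq_fset1 mcoeffUU scale1r. Qed.

Lemma malg_ext (f g : {linear {malg A[X]} -> M}) :
  (forall x, f << x >> = g << x >>) -> f =1 g.
Proof.
move=> fg v; rewrite [v]malg_genE !linear_sum; apply: eq_bigr => x _ /=.
by rewrite !linearZ fg.
Qed.
End FreeModule.

Section FoxCalculus.
Variables (X : choiceType) (G : groupType).
Variable f : {multiplicative free_group X -> G}.
Notation A := (group_ring G).
Notation AX := {malg A[X]}.
Implicit Types (l : letter X) (w : seq (letter X)) (a b : free_group X) (g h : G).

Definition group_elt g : A := << g >>.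

Lemma group_eltM g h : group_elt (g * h)%g = group_elt g * group_elt h.
Proof. by rewrite /GRing.mul/= /group_elt group_ring_mulUU mulr1. Qed.

Lemma group_elt1 : group_elt 1%g = 1. Proof. by []. Qed.

Lemma group_eltE (z : A) : z = \sum_(g <- msupp z) group_elt g *~ z@_g.
Proof.
rewrite {1}[z]monalgE; apply: eq_bigr => g _.
apply/malgP => h; rewrite mcoeffMz /group_elt !mcoeffU.
by case: eqP => _; rewrite ?mulr0n ?mul0rz ?mulr1n ?intz.
Qed.

Lemma hom_one : f 1%g = 1%g.
Proof. by apply: (mulgI (f 1%g)); rewrite -gmulfM !mulg1. Qed.

Definition letter_elt l : free_group X := @FreeGroup X [:: l] isT.

Definition letter_val l : G := f (letter_elt l).

Lemma letter_valV l : (letter_val l * letter_val (letter_inv l) = 1)%g.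
Proof.
rewrite -gmulfM -[RHS]hom_one; congr (f _); apply/val_inj.
by rewrite /= eqxx.
Qed.

Definition word_val w : G := foldr (fun l g => letter_val l * g)%g 1%g w.

Lemma word_valE a : f a = word_val a.
Proof.
case: a => w rw; elim: w rw => [|l w IH] rw /=.
  by rewrite -hom_one; congr (f _); apply/val_inj.
have rw' : reduced_word w by apply: path_sorted rw.
rewrite -(IH rw') -gmulfM; congr (f _); apply/val_inj => /=.
by case: w rw {rw' IH} => //= h w /andP[/negPf ->].
Qed.

Definition fox_letter l : AX :=
  if l.2 then - (group_elt (letter_val l) *: << l.1 >>) else << l.1 >>.

(** The Fox derivative of a word, with coefficients mapped to Z[G]: the crossed
    homomorphism that sends each generator x to << x >>. *)
Definition fox w : AX :=
  foldr (fun l v => fox_letter l + group_elt (letter_val l) *: v) 0 w.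

Lemma fox_letterV l :
  fox_letter l + group_elt (letter_val l) *: fox_letter (letter_inv l) = 0.
Proof.
case: l => x [] /=; rewrite /fox_letter /=; first by rewrite addNr.
by rewrite scalerN scalerA -group_eltM letter_valV group_elt1 scale1r subrr.
Qed.

Lemma fox_push l w :
  fox (push l w) = fox_letter l + group_elt (letter_val l) *: fox w.
Proof.
case: w => [|h w] //=; case: eqVneq => [->|//].
rewrite scalerDr addrA fox_letterV add0r scalerA -group_eltM letter_valV.
by rewrite group_elt1 scale1r.
Qed.

Lemma foxM a b : fox (a * b)%g = fox a + group_elt (f a) *: fox b.
Proof.
rewrite word_valE; case: a => w rw /=; elim: w {rw} => [|l w IH] /=.
  by rewrite add0r group_elt1 scale1r.
rewrite fox_push IH scalerDr addrA scalerA group_eltM.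
exact: erefl.
Qed.

Definition relation_boundary : AX -> A :=
  malg_lift (fun x => group_elt (letter_val (x, false)) - 1 : A^o).

Lemma relation_boundary_is_zmod : zmod_morphism relation_boundary.
Proof. exact: (raddfB (malg_lift (M := A^o) _)). Qed.

HB.instance Definition _ :=
  GRing.isZmodMorphism.Build AX A relation_boundary relation_boundary_is_zmod.

Lemma boundaryZ (z : A) v : relation_boundary (z *: v) = z * relation_boundary v.
Proof.
exact: (linearZ_LR (malg_lift (fun x => group_elt (letter_val (x, false)) - 1 : A^o))).
Qed.

Lemma boundaryD u v :
  relation_boundary (u + v) = relation_boundary u + relation_boundary v.
Proof. exact: raddfD. Qed.

Lemma boundaryN v : relation_boundary (- v) = - relation_boundary v.
Proof. exact: raddfN. Qed.

Lemma boundaryU x :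
  relation_boundary << x >> = group_elt (letter_val (x, false)) - 1.
Proof. exact: (malg_liftU (M := A^o)). Qed.

Lemma boundary_fox a : relation_boundary (fox a) = group_elt (f a) - 1.
Proof.
rewrite word_valE; case: a => w rw /=; elim: w {rw} => [|l w IH] /=.
  by rewrite raddf0 group_elt1 subrr.
rewrite boundaryD boundaryZ IH /fox_letter group_eltM mulrBr mulr1.
case: l => x [] /=; rewrite ?boundaryN ?boundaryZ boundaryU.
  have := letter_valV (x, true); rewrite /letter_inv /= => xV.
  rewrite mulrBr -(group_eltM _ (letter_val (x, false))) xV mulr1 group_elt1 opprB.
  by rewrite addrC addrA subrK.
by rewrite addrC addrA subrK.
Qed.

Lemma augmentation_boundary v : augmentation (relation_boundary v) = 0.
Proof.
rewrite [v]malg_genE raddf_sum /=.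
rewrite (big_morph _ (@augmentationD G) (augmentation0 G)) big1 // => x _.
rewrite boundaryZ augmentationM boundaryU.
have -> : augmentation (group_elt (letter_val (x, false)) - 1) = 0.
  apply: (addIr (augmentation (1 : A))); rewrite -augmentationD subrK add0r.
  by rewrite !augmentationU.
by rewrite mulr0.
Qed.

Section Presentation.
Variables (n : nat) (r : 'I_n -> free_group X).
Hypothesis f_onto : (range f = [set: G])%classic.
Hypothesis f_ker : (f @^-1` [set 1%g])%classic = normal_closure (range r).

Notation combination := (lincomb (fun i => fox (r i))).

Let in_span (v : AX) := exists c, v = combination c.

Let in_spanD u v : in_span u -> in_span v -> in_span (u + v).
Proof. by move=> [a ->] [b ->]; exists (a + b); rewrite raddfD. Qed.

Let in_spanZ z v : in_span v -> in_span (z *: v).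
Proof. by move=> [a ->]; exists (z *: a); rewrite lincombZ. Qed.

Let fox_relator i : in_span (fox (r i)).
Proof. by exists (delta_mx 0 i); rewrite lincomb_delta. Qed.

(** The elements with both properties form a normal subgroup that contains the
    relators. *)
Let fox_ker a : f a = 1%g -> in_span (fox a).
Proof.
pose N : set (free_group X) := [set a | f a = 1%g /\ in_span (fox a)]%classic.
have fV b : (f b^-1 * f b = 1)%g by rewrite -gmulfM mulVg hom_one.
have fox1 : fox (1%g : free_group X) = 0 by [].
suff NN : normal_subgroup N.
  move=> fa; have : normal_closure (range r) a by rewrite -f_ker.
  move=> /(_ N)[]//; split=> // _ [i _ <-]; split; last exact: fox_relator.
  have : (f @^-1` [set 1%g])%classic (r i); last by [].
  by rewrite f_ker => M [_]; apply; exists i.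
have NJ b c : N b -> N (b ^ c)%g.
  move=> [fb Nb]; split.
    by rewrite conjgE !gmulfM fb mul1g fV.
  rewrite conjgE !foxM fb group_elt1 scale1r scalerDr addrCA -foxM mulVg fox1 addr0.
  exact: in_spanZ.
split=> //.
- split; first exact: hom_one.
  by exists 0; rewrite raddf0.
- move=> b c [fb Nb] [fc Nc]; split; first by rewrite gmulfM fb fc mulg1.
  by rewrite foxM; apply: in_spanD => //; apply: in_spanZ.
- move=> b [fb Nb]; have := fV b; rewrite fb mulg1 => fb'; split=> //.
  have : fox (b^-1 * b)%g = 0 by rewrite mulVg fox1.
  rewrite foxM fb' group_elt1 scale1r => /eqP; rewrite addr_eq0 => /eqP ->.
  by rewrite -scaleN1r; apply: in_spanZ.
Qed.

Let fox_coset a b : f a = f b -> in_span (fox a - fox b).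
Proof.
move=> fab; have fabV : f (a * b^-1)%g = 1%g.
  by rewrite gmulfM fab -gmulfM mulgV hom_one.
have -> : fox a = fox (a * b^-1 * b)%g by rewrite -mulgA mulVg mulg1.
by rewrite foxM fabV group_elt1 scale1r addrK; apply: fox_ker.
Qed.

Let rep g : free_group X := xget 1%g (f @^-1` [set g])%classic.

Let repK g : f (rep g) = g.
Proof.
have [a _ fa] : (range f)%classic g by rewrite f_onto.
by rewrite /rep; case: xgetP => [b _ //|/(_ a)].
Qed.

(** Additive but not linear over the group ring: a contracting homotopy, up to
    the span of the Fox derivatives of the relators. *)
Let contraction (z : A) : AX := \sum_(g <- msupp z) fox (rep g) *~ z@_g.

Let contractionw (D : {fset G}) z : (msupp z `<=` D)%fset ->
  contraction z = \sum_(g <- D) fox (rep g) *~ z@_g.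
Proof.
move=> zD; rewrite /contraction (big_fset_incl _ zD)//= => g _ /mcoeff_outdom ->.
by rewrite mulr0z.
Qed.

Let contraction_is_zmod : zmod_morphism contraction.
Proof.
move=> y z; pose D := (msupp y `|` msupp z `|` msupp (y - z))%fset.
rewrite !(@contractionw D) /D; first last.
- by rewrite fsubsetUr.
- by rewrite -fsetUA fsubsetUl.
- by rewrite (fsubset_trans (fsubsetUr (msupp y) _)) ?fsubsetUl.
by rewrite -sumrB; apply: eq_bigr => g _; rewrite mcoeffB mulrzBr.
Qed.

HB.instance Definition _ :=
  GRing.isZmodMorphism.Build A AX contraction contraction_is_zmod.

Let contraction_elt g : contraction (group_elt g) = fox (rep g).
Proof. by rewrite (contractionw msuppU_le) big_seq_fset1 mcoeffUU mulr1z. Qed.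

(** By additivity it is enough to take v = g x. There the difference is that of
    the Fox derivatives of two words with the same value in G. *)
Let contraction_boundary v : in_span (v - contraction (relation_boundary v)).
Proof.
have in_span_sum I (s : seq I) (F : I -> AX) :
    (forall i, in_span (F i)) -> in_span (\sum_(i <- s) F i).
  move=> FN; apply: big_ind => [|u w|i _]; [|exact: in_spanD|exact: FN].
  by exists 0; rewrite raddf0.
pose defect u := u - contraction (relation_boundary u).
have defectD : {morph defect : u w / u + w}.
  by move=> u w; rewrite /defect boundaryD raddfD /= addrACA -opprD.
have defect0 : defect 0 = 0 by rewrite /defect (raddf0 relation_boundary) (raddf0 contraction) subr0.
rewrite -/(defect v) [v]malg_genE (big_morph _ defectD defect0).
apply: (in_span_sum) => x; rewrite [v@_x]group_eltE scaler_suml.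
rewrite (big_morph _ defectD defect0); apply: in_span_sum => g.
have defectMz u k : defect (u *~ k) = defect u *~ k.
  rewrite /defect mulrzBl; congr (_ - _).
  by rewrite (raddfMz relation_boundary) (raddfMz contraction).
rewrite -scalerMzl defectMz -scaler_int; apply: in_spanZ; rewrite /defect.
rewrite boundaryZ boundaryU mulrBr mulr1 -group_eltM raddfB/= !contraction_elt.
set b := rep g; set c := rep _; rewrite opprB addrA.
have -> : group_elt g *: << x >> + fox b = fox (b * letter_elt (x, false))%g.
  by rewrite foxM repK /= /fox_letter /= scaler0 addr0 addrC.
by apply: fox_coset; rewrite gmulfM !repK.
Qed.

Lemma fox_exact v : relation_boundary v = 0 -> exists c, v = combination c.
Proof. by move=> v0; have := contraction_boundary v; rewrite v0 raddf0 subr0. Qed.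

Lemma boundary_relator c : relation_boundary (combination c) = 0.
Proof.
rewrite /lincomb raddf_sum big1 //= => i _; rewrite boundaryZ boundary_fox.
have : (f @^-1` [set 1%g])%classic (r i) by rewrite f_ker => M [_]; apply; exists i.
by move=> /= ->; rewrite group_elt1 subrr mulr0.
Qed.

Lemma augmentation_exact z : augmentation z = 0 -> exists v, relation_boundary v = z.
Proof.
move=> z0; exists (contraction z).
rewrite /contraction raddf_sum/=.
under eq_bigr do rewrite raddfMz/= boundary_fox repK.
exact: (sum_mulrzB (F := @group_elt) _ (group_eltE z) z0).
Qed.

End Presentation.

End FoxCalculus.

(** * The Eilenberg swindle *)

Lemma linear_lincomb (A : nzRingType) (V W : lmodType A) n (g : {linear V -> W})
  (r : 'I_n -> V) u : g (lincomb r u) = lincomb (fun i => g (r i)) u.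
Proof. by rewrite /lincomb linear_sum; apply: eq_bigr => i _; rewrite linearZ. Qed.

Section Swindle.
Variables (A : nzRingType) (X : choiceType) (n : nat).
Variables (r : 'I_n -> {malg A[X]}) (P : 'M[A]_n).
Hypothesis rP : forall u, lincomb r (u *m P) = 0.
Hypothesis P_id : forall v, lincomb r v = 0 -> v *m P = v.

Definition slot_index : choiceType := (nat * 'I_n)%type.
Definition sum_index : choiceType := (X + slot_index)%type.
Notation W := {malg A[slot_index]}.
Notation F1 := {malg A[sum_index]}.

Let Q : 'M[A]_n := 1%:M - P.

Let PP : P *m P = P.
Proof. by apply/row_matrixP => i; rewrite row_mul rowE P_id. Qed.

Let PQ : P *m Q = 0.
Proof. by rewrite mulmxBr mulmx1 PP subrr. Qed.

Let QP : Q *m P = 0.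
Proof. by rewrite mulmxBl mul1mx PP subrr. Qed.

Let QQ : Q *m Q = Q.
Proof. by rewrite {1}/Q mulmxBl mul1mx PQ subr0. Qed.

Definition slot (k : nat) (u : 'rV[A]_n) : W :=
  lincomb (fun i => << ((k, i) : slot_index) >>) u.

HB.instance Definition _ k :=
  GRing.isZmodMorphism.Build 'rV[A]_n W (slot k) (lincomb_is_zmod _).

Lemma slot0 k : slot k 0 = 0. Proof. exact: raddf0. Qed.

Lemma slot_delta k i : slot k (delta_mx 0 i) = << ((k, i) : slot_index) >>.
Proof. exact: lincomb_delta. Qed.

Definition injl : {malg A[X]} -> F1 := malg_lift (fun x => << (inl x : sum_index) >>).
Definition injr : W -> F1 := malg_lift (fun y => << (inr y : sum_index) >>).
Definition projl : F1 -> {malg A[X]} :=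
  malg_lift (fun z : sum_index => if z is inl x then << x >> else 0).
Definition projr : F1 -> W :=
  malg_lift (fun z : sum_index => if z is inr y then << y >> else 0).
HB.instance Definition _ := GRing.Linear.on injl.
HB.instance Definition _ := GRing.Linear.on injr.
HB.instance Definition _ := GRing.Linear.on projl.
HB.instance Definition _ := GRing.Linear.on projr.

Lemma injlK : cancel injl projl.
Proof.
apply: (malg_ext (f := projl \o injl) (g := idfun)) => x /=.
by rewrite /injl malg_liftU /projl malg_liftU.
Qed.

Lemma sum_split v : v = injl (projl v) + injr (projr v).
Proof.
apply: (malg_ext (f := idfun) (g := (injl \o projl) \+ (injr \o projr))) => z /=.
rewrite /projl /projr !malg_liftU.
by case: z => z; rewrite raddf0 ?addr0 ?add0r /injl /injr malg_liftU.
Qed.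

(** Let K and M be the images of P and Q, with A^n their direct sum. The module W
    is M_0 + (K_0 + M_1) + (K_1 + M_2) + ..., and F1 is A^X + A^n + A^n + ...
    The map swindle sends M_0 to A^X by lincomb r, and K_j + M_(j+1) onto the
    j-th copy of A^n. *)
Definition swindle_lower (k : nat) (u : 'rV[A]_n) : F1 :=
  if k is j.+1 then injr (slot j (u *m Q)) else injl (lincomb r u).

Definition swindle : W -> F1 := malg_lift (fun y : slot_index =>
  swindle_lower y.1 (delta_mx 0 y.2) + injr (slot y.1 (delta_mx 0 y.2 *m P))).
HB.instance Definition _ := GRing.Linear.on swindle.

Lemma swindle_slot k u :
  swindle (slot k u) = swindle_lower k u + injr (slot k (u *m P)).
Proof.
have lin j (M : 'M[A]_n) : injr (slot j (u *m M)) =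
    lincomb (fun i => injr (slot j (delta_mx 0 i *m M))) u.
  rewrite /slot lincomb_mul linear_lincomb /lincomb.
  by apply: eq_bigr => i _; rewrite rowE.
have -> : swindle_lower k u = lincomb (fun i => swindle_lower k (delta_mx 0 i)) u.
  case: k => [|k] /=; last exact: lin.
  rewrite linear_lincomb /lincomb; apply: eq_bigr => i _.
  by rewrite -/(lincomb _ _) lincomb_delta.
rewrite lin [in LHS]/slot linear_lincomb /lincomb -big_split; apply: eq_bigr => i _ /=.
by rewrite /swindle malg_liftU /= scalerDr.
Qed.

(** The inverse of swindle away from M_0. *)
Definition unswindle : F1 -> W := malg_lift (fun z : sum_index =>
  if z is inr y then slot y.1 (delta_mx 0 y.2 *m P) + slot y.1.+1 (delta_mx 0 y.2 *m Q)
  else 0).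
HB.instance Definition _ := GRing.Linear.on unswindle.

Lemma unswindle_injr_slot k u :
  unswindle (injr (slot k u)) = slot k (u *m P) + slot k.+1 (u *m Q).
Proof.
have lin j (M : 'M[A]_n) : slot j (u *m M) =
    lincomb (fun i => slot j (delta_mx 0 i *m M)) u.
  by rewrite /slot lincomb_mul /lincomb; apply: eq_bigr => i _; rewrite rowE.
rewrite !lin [in LHS]/slot !linear_lincomb /lincomb -big_split.
apply: eq_bigr => i _ /=.
by rewrite /injr malg_liftU /unswindle malg_liftU /= scalerDr.
Qed.

Lemma unswindle_injl x : unswindle (injl x) = 0.
Proof.
apply: (malg_ext (f := unswindle \o injl) (g := \0)) => y /=.
by rewrite /injl malg_liftU /unswindle malg_liftU.
Qed.

Lemma unswindleK w : swindle (unswindle (injr w)) = injr w.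
Proof.
apply: (malg_ext (f := swindle \o (unswindle \o injr)) (g := injr)) => -[k i] /=.
rewrite -slot_delta unswindle_injr_slot raddfD /= !swindle_slot.
set u := delta_mx 0 i.
have -> : swindle_lower k (u *m P) = 0.
  case: k => [|k] /=; first by rewrite rP raddf0.
  by rewrite -mulmxA PQ mulmx0 slot0 raddf0.
rewrite /= -!mulmxA PP QQ QP mulmx0 slot0 raddf0 add0r addr0.
by rewrite -(raddfD injr) -(raddfD (slot k)) -mulmxDr addrC subrK mulmx1.
Qed.

Definition swindle_defect : W -> W := malg_lift (fun y : slot_index =>
  if y.1 is 0%N then slot 0 (delta_mx 0 y.2 *m Q) else 0).
HB.instance Definition _ := GRing.Linear.on swindle_defect.

Lemma swindleK v : unswindle (swindle v) = v - swindle_defect v.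
Proof.
apply: (malg_ext (f := unswindle \o swindle) (g := idfun \- swindle_defect)) => -[k i] /=.
rewrite -{1 2}slot_delta swindle_slot raddfD /= unswindle_injr_slot.
rewrite /swindle_defect malg_liftU /= -!mulmxA PP PQ mulmx0 slot0 addr0.
set u := delta_mx 0 i.
case: k => [|k] /=; first rewrite unswindle_injl add0r.
  by rewrite -(raddfB (slot 0%N)) /Q mulmxBr mulmx1 opprB addrCA subrr addr0.
rewrite unswindle_injr_slot -!mulmxA QP QQ mulmx0 slot0 add0r subr0.
by rewrite -(raddfD (slot k.+1)) -mulmxDr subrK mulmx1.
Qed.

Lemma swindle_defect_slot v : exists u, swindle_defect v = slot 0 (u *m Q).
Proof.
rewrite /swindle_defect /malg_lift; apply: (big_ind (fun w => exists u, w = slot 0 (u *m Q))).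
- by exists 0; rewrite mul0mx slot0.
- by move=> _ _ [u ->] [w ->]; exists (u + w); rewrite mulmxDl (raddfD (slot 0%N)).
- move=> [[|k] i] _ /=; last by exists 0; rewrite scaler0 mul0mx slot0.
  exists (v@_((0%N, i) : slot_index) *: delta_mx 0 i).
  by rewrite -scalemxAl /slot lincombZ.
Qed.

Lemma projl_swindle v : exists c, projl (swindle v) = lincomb r c.
Proof.
rewrite {1}[v]malg_genE (linear_sum swindle) (linear_sum projl).
apply: (big_ind (fun w => exists c, w = lincomb r c)).
- by exists 0; rewrite raddf0.
- by move=> _ _ [u ->] [w ->]; exists (u + w); rewrite raddfD.
move=> [k i] _; rewrite (linearZ_LR swindle) (linearZ_LR projl) /= /swindle malg_liftU /=.
have -> : projl (swindle_lower k (delta_mx 0 i) +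
    injr (slot k (delta_mx 0 i *m P))) = if k is 0%N then r i else 0.
  have projl_injr w : projl (injr w) = 0.
    apply: (malg_ext (f := projl \o injr) (g := \0)) => z /=.
    by rewrite /injr malg_liftU /projl malg_liftU.
  rewrite raddfD /= projl_injr addr0.
  by case: k => [|k] /=; rewrite ?projl_injr// injlK lincomb_delta.
case: k => [|k]; last by exists 0; rewrite scaler0 raddf0.
by exists (v@_((0%N, i) : slot_index) *: delta_mx 0 i); rewrite lincombZ lincomb_delta.
Qed.

(** By swindleK an element of the kernel lies in M_0, on which lincomb r is
    injective. *)
Lemma swindle_inj v : swindle v = 0 -> v = 0.
Proof.
move=> v0; have := swindleK v; rewrite v0 raddf0 => /esym/eqP; rewrite subr_eq0.
have [u ->] := swindle_defect_slot v => /eqP vE.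
move: v0; rewrite vE swindle_slot /= -mulmxA QP mulmx0 slot0 raddf0 addr0.
move=> /(congr1 projl); rewrite injlK raddf0 => /P_id.
by rewrite -mulmxA QP mulmx0 => <-; rewrite slot0.
Qed.

(** The part of c in K does not contribute to lincomb r c. *)
Lemma swindle_lift c : injl (lincomb r c) = swindle (slot 0 (c *m Q)).
Proof.
rewrite swindle_slot -mulmxA QP mulmx0 slot0 raddf0 addr0 /=.
by rewrite mulmxBr mulmx1 raddfB/= rP subr0.
Qed.

End Swindle.

Section Resolution.
Variables (X : choiceType) (G : groupType) (f : {multiplicative free_group X -> G}).
Variables (n : nat) (r : 'I_n -> free_group X).
Hypothesis f_onto : (range f = [set: G])%classic.
Hypothesis f_ker : (f @^-1` [set 1%g])%classic = normal_closure (range r).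
Notation A := (group_ring G).
Let R i : {malg A[X]} := fox f (r i).
Variable P : 'M[A]_n.
Hypothesis rP : forall u, lincomb R (u *m P) = 0.
Hypothesis P_id : forall v, lincomb R v = 0 -> v *m P = v.

Let cells (i : nat) : choiceType :=
  match i with 0 => unit | 1 => sum_index X n | 2 => slot_index n | _ => void end.

Let F (i : nat) : lmodType A := {malg A[cells i]}.

Let d1 : {linear F 1 -> F 0} := malg_lift (fun z : sum_index X n =>
  if z is inl x then relation_boundary f << x >> *: (<< tt >> : {malg A[unit]}) else 0).

Let d (i : nat) : {linear F i.+1 -> F i} :=
  match i with
  | 0 => d1
  | 1 => swindle R P
  | _ => malg_lift (fun _ => 0)
  end.

Let e : {linear F 0 -> trivial_module G} := malg_lift (fun _ => 1 : trivial_module G).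

Let d1E y : d1 y = relation_boundary f (projl y) *: (<< tt >> : {malg A[unit]}).
Proof.
have d1_injr w : d1 (injr X w) = 0.
  apply: (malg_ext (f := d1 \o @injr A X n) (g := \0)) => z /=.
  by rewrite /injr malg_liftU /d1 /= malg_liftU.
rewrite [y in LHS]sum_split raddfD /= (d1_injr (projr y)) addr0.
move: (projl y) => x; rewrite {1}[x]malg_genE [x in RHS]malg_genE.
rewrite (linear_sum (@injl A X n)) linear_sum raddf_sum scaler_suml /=.
apply: eq_bigr => z _; rewrite boundaryZ -scalerA.
rewrite (linearZ_LR (@injl A X n)) (linearZ_LR d1); congr (_ *: _).
by rewrite /= /injl malg_liftU malg_liftU.
Qed.

Let unitE (v : {malg A[unit]}) : v = v@_tt *: (<< tt >> : {malg A[unit]}).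
Proof. by apply/malgP => -[]; rewrite mcoeffZ mcoeffUU mulr1. Qed.

Let eE v : e v = augmentation (v@_tt) :> int.
Proof.
rewrite [v in LHS]unitE linearZ /= malg_liftU.
by rewrite -[RHS]mulr1.
Qed.

(** Exactness in degree 1 combines fox_exact with the surjectivity of swindle
    onto the copies of A^n; in degree 2 it is the injectivity of swindle. *)
Lemma resolution_of_projection : cohomological_dimension_le G 2.
Proof.
exists 2%N; split=> //; exists F, d, e; split.
- by move=> i; exists (cells i), idfun; exists idfun.
- apply/seteqP; split=> // k _.
  exists ((<< k *g 1%g >> : A) *: (<< tt >> : {malg A[unit]})) => //.
  by rewrite eE mcoeffZ mcoeffUU mulr1 augmentationU.
- apply/seteqP; split=> [_ [y _ <-]|v /= v0].
    by rewrite /= d1E eE mcoeffZ mcoeffUU mulr1 augmentation_boundary.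
  have [x xE] := augmentation_exact f_onto (etrans (esym (eE v)) v0).
  exists (injl n x) => //.
  by rewrite d1E injlK xE -unitE.
- move=> [|[|i]] /=.
  + apply/seteqP; split=> [_ [v _ <-]|y /= y0].
      rewrite /= d1E.
      have [c ->] := projl_swindle R P v.
      by rewrite (boundary_relator f_ker) scale0r.
    have /(fox_exact f_onto f_ker)[c cE] : relation_boundary f (projl y) = 0.
      have := congr1 (mcoeff tt) (etrans (esym (d1E y)) y0).
      by rewrite mcoeffZ mcoeffUU mulr1 mcoeff0.
    exists (slot 0 (c *m (1%:M - P)) + unswindle P (injr X (projr y))) => //.
    by rewrite raddfD /= (unswindleK rP P_id) -(swindle_lift rP P_id) -cE -sum_split.
  + apply/seteqP; split=> [_ [v _ <-]|v /= v0].
      by rewrite /malg_lift /= big1 ?raddf0 // => ? _; rewrite scaler0.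
    exists 0 => //; rewrite (swindle_inj rP P_id v0) raddf0 //.
  + apply/seteqP; split=> [_ [v _ <-]|v /= v0].
      by rewrite /= [LHS]big1 // => ? _; rewrite scaler0.
    by exists 0 => //; apply/malgP => y; case: (y : void).
- by move=> [|[|[|i]]]//= _ x; apply/malgP => y; case: (y : void).
Qed.
End Resolution.

(** * Splittings modulo a prime *)

Lemma dvdz_prime0 (p : nat) (a b : int) : p = 0%N \/ prime p ->
  ~~ (p %| a)%Z -> ~~ (p %| b)%Z -> ~~ (p %| a * b)%Z.
Proof.
case=> [->|pp]; first by rewrite !dvd0z mulf_eq0 negb_or => -> ->.
by rewrite !dvdzE abszM Euclid_dvdM// negb_or => -> ->.
Qed.

Lemma mxMzE (V : zmodType) m n (M : 'M[V]_(m, n)) k i j :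
  (M *~ k) i j = M i j *~ k.
Proof. by case: k => k; rewrite ?NegzE ?mulrNz -!pmulrn ?mxE mulmxnE. Qed.

Section BaseChange.
Variables (A : nzRingType) (V : lmodType A) (n p : nat) (r : 'I_n -> V).
Hypothesis p0 : p = 0%N \/ prime p.

(** Conjugate the map for the new generators by Q; as Q' *m Q = c, the factor s
    becomes c * s. *)
Lemma splits_mod_base_change (Q Q' : 'M[A]_n) (c : int) : ~~ (p %| c)%Z ->
  Q' *m Q = 1%:M *~ c ->
  splits_mod (fun i => lincomb r (row i Q)) p -> splits_mod r p.
Proof.
move=> pc QQ [P [s [ps rP vP]]]; exists (Q' *m P *m Q), (c * s).
have mulmxMzr m1 m2 m3 (M : 'M[A]_(m1, m2)) (N : 'M[A]_(m2, m3)) k :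
  M *m (N *~ k) = (M *m N) *~ k by exact: (raddfMz (mulmx M)).
split; first exact: dvdz_prime0.
  by move=> u; rewrite !mulmxA lincomb_mul; apply: rP.
move=> v pv.
have -> : v *m (Q' *m P *m Q) - v *~ (c * s) = (v *m Q' *m P - (v *m Q') *~ s) *m Q.
  rewrite mulmxBl !mulmxA; congr (_ - _); rewrite mulrzA.
  have -> : v *~ c = v *m Q' *m Q by rewrite -mulmxA QQ mulmxMzr mulmx1.
  exact/esym/(raddfMz (mulmxr Q) s (v *m Q')).
apply: (divides_raddf (mulmxr Q)); apply: vP.
rewrite -lincomb_mul -mulmxA QQ mulmxMzr mulmx1 lincombMz.
exact: divides_mulrz.
Qed.

(** The base change matrix differs from 1 in row i0, whose diagonal entry is c
    times a unit; so it is invertible up to the factor c. *)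
Lemma splits_mod_replace i0 (w : 'rV[A]_n) (c : int) (g h : A) :
  ~~ (p %| c)%Z -> h * g = 1 -> w 0 i0 = g *~ c ->
  splits_mod (fun i => if i == i0 then lincomb r w else r i) p -> splits_mod r p.
Proof.
move=> pc hg wi0 split_r.
pose e : 'rV[A]_n := delta_mx 0 i0.
pose Q : 'M[A]_n := \matrix_i (if i == i0 then w else delta_mx 0 i).
pose Q' : 'M[A]_n :=
  \matrix_i (if i == i0 then h *: (e - w + w 0 i0 *: e) else delta_mx 0 i *~ c).
(* Q is a rank one perturbation of 1. *)
have QE u : u *m Q = u + u 0 i0 *: (w - e).
  rewrite mulmx_sum_row (bigD1 i0)//= rowK eqxx.
  have -> : \sum_(i < n | i != i0) u 0 i *: row i Q = u - u 0 i0 *: e.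
    rewrite [u in RHS]row_sum_delta; apply/esym/eqP; rewrite subr_eq addrC.
    rewrite {1}(bigD1 i0)//= -row_sum_delta eq_sym; apply/eqP; congr (_ + _).
    by apply: eq_bigr => i ii0; rewrite rowK (negPf ii0).
  by rewrite scalerBr addrCA.
apply: (@splits_mod_base_change Q Q' c) => //; last first.
  move: split_r; congr (splits_mod _ p); apply/funext => i; rewrite rowK.
  by case: eqP => // _; rewrite lincomb_delta.
apply/row_matrixP => i; rewrite row_mul rowK (raddfMz (row i)) /= row1.
case: eqP => [->|/eqP ii0].
  rewrite -scalemxAl QE !mxE !eqxx /= mulr1 addrNK scale1r.
  have -> : e - w + w 0 i0 *: e + (w - e) = w 0 i0 *: e.
    by rewrite addrAC -[w - e]opprB subrr add0r.
  by rewrite scalerA wi0 mulrzAr hg -scalerMzl scale1r.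
rewrite QE.
have -> : (delta_mx 0 i *~ c : 'rV[A]_n) 0 i0 = 0.
  by rewrite mxMzE !mxE eqxx eq_sym (negPf ii0) mul0rz.
by rewrite scale0r addr0.
Qed.
End BaseChange.

Lemma mcoeff_group_eltM (G : groupType) (g : G) (b : group_ring G) h :
  (group_elt g * b)@_h = b@_(g^-1 * h)%g.
Proof.
rewrite [_ * _](group_ring_mulw msuppU_le (fsubset_refl _)) big_seq_fset1 mcoeffUU.
rewrite raddf_sum /= ; under eq_bigr do rewrite mcoeffU mul1r.
have E k : (g * k == h)%g = (k == g^-1 * h)%g.
  by apply/eqP/eqP => [<-|->]; rewrite mulgA ?mulVg ?mulgV mul1g.
under eq_bigr do rewrite E.
have [hb|hb] := boolP (g^-1 * h \in msupp b)%g.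
  rewrite (big_fsetD1 _ hb) /= eqxx mulr1n big_seq big1 ?addr0 // => k.
  by rewrite !inE => /andP[/negPf ->]; rewrite mulr0n.
rewrite big_seq big1 ?(mcoeff_outdom hb) // => k kb.
by case: eqP => [kE|]; rewrite ?mulr0n // -kE kb in hb.
Qed.

Lemma seq_argmax (R : realType) (I : eqType) (s : seq I) (F : I -> R) :
  s != [::] -> exists2 x, x \in s & forall y, y \in s -> F y <= F x.
Proof.
elim: s => // x [|y s] IH _; first by exists x; rewrite ?mem_head// => y /[!inE] /eqP ->.
have [z zs zF] := IH isT; have [xz|zx] := leP (F x) (F z).
  exists z; first by rewrite in_cons zs orbT.
  by move=> w; rewrite in_cons => /orP[/eqP ->//|]; exact: zF.
exists x; first exact: mem_head.
move=> w; rewrite in_cons => /orP[/eqP ->//|/zF wz].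
exact: le_trans wz (ltW zx).
Qed.

Section Local.
Variables (R : realType) (H : metricType R) (G : groupType) (act : G -> H -> H).
Hypothesis H_hyp : hyperbolic_space 1 H.
Hypothesis act_iso : isometric_action act.
Variables (n l : nat).
Hypothesis l_large : (2 * n + 3 <= 2 ^ l)%N.
Hypothesis act_far : forall g q, g <> 1%g ->
  separation R n l < mdist (act g q) q.
Variables (X : choiceType) (p : nat).
Hypothesis p0 : p = 0%N \/ prime p.
Variable o : H.
Notation A := (group_ring G).
Notation AX := {malg A[X]}.
Implicit Types (v : AX) (g h : G).

Definition entry v x h : int := (v@_x)@_h.

Definition supp_mod v : seq G :=
  [seq h <- flatten [seq (msupp v@_x : seq G) | x <- msupp v] |
    has (fun x => ~~ (p %| entry v x h)%Z) (msupp v)].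

Lemma supp_modP v h : reflect (exists x, ~~ (p %| entry v x h)%Z) (h \in supp_mod v).
Proof.
rewrite mem_filter; apply: (iffP andP) => [[/hasP[x _ px] _]|[x px]]; first by exists x.
have vxh : entry v x h != 0 by apply: contraNneq px => ->; rewrite dvdz0.
have xv : x \in msupp v.
  by rewrite -mcoeff_neq0; apply: contraNneq vxh; rewrite /entry => ->; rewrite mcoeff0.
split; first by apply/hasP; exists x.
have hv : h \in msupp v@_x by rewrite -mcoeff_neq0.
by apply/flattenP; exists (msupp v@_x : seq G); first by apply/mapP; exists x.
Qed.

Lemma divides_coef (a : A) : (forall h, (p %| a@_h)%Z) -> divides p a.
Proof.
move=> pa; rewrite [a]group_eltE; apply: divides_sum => g _.
have /dvdzP[k ->] := pa g; rewrite mulrzA -pmulrn; exact: divides_Mn.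
Qed.

Lemma divides_support v : supp_mod v = [::] -> divides p v.
Proof.
move=> v0; rewrite [v]malg_genE; apply: divides_sum => x _.
have [h|b ->] := divides_coef (a := v@_x); last first.
  by exists (b *: << x >>); rewrite scalerMnl.
by apply/negPn/negP => px; have : h \in supp_mod v by [apply/supp_modP; exists x]; rewrite v0.
Qed.

(** For k = 0 the support is empty. Hence the sum of such bounds decreases also
    when a generator becomes 0 modulo p. *)
Definition diam_lt v (k : nat) := forall g h, g \in supp_mod v -> h \in supp_mod v ->
  mdist (act g o) (act h o) < k%:R.

Let four_point (q1 q2 q3 q4 : H) :
  Num.min (gromov_product q1 q4 q3) (gromov_product q4 q2 q3) - 1
    <= gromov_product q1 q2 q3.
Proof. exact: hyperbolic_gromov. Qed.

Lemma midpoint_exists (q1 q2 : H) : exists m : H,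
  mdist m q1 = mdist q1 q2 / 2 /\ mdist m q2 = mdist q1 q2 / 2.
Proof.
have [c [c0 c1 ciso]] := hyperbolic_geodesic H_hyp q1 q2.
have d0 : 0 <= mdist q1 q2 by exact: mdist_ge0.
exists (c (mdist q1 q2 / 2)); split.
- rewrite -[X in mdist _ X]c0 ciso ?in_itv /=; [|lra|lra].
  by rewrite subr0 ger0_norm; lra.
- rewrite -[X in mdist _ X]c1 ciso ?in_itv /=; [|lra|lra].
  by rewrite distrC ger0_norm; lra.
Qed.

Lemma exists_diam_lt v : exists k, diam_lt v k.
Proof.
pose pairs := [seq (g, h) | g <- supp_mod v, h <- supp_mod v].
have inP g h : g \in supp_mod v -> h \in supp_mod v -> (g, h) \in pairs.
  by move=> gs hs; apply/allpairsP; exists (g, h).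
have [pairs0|pairs0] := eqVneq pairs [::].
  by exists 0%N => g h gs hs; have := inP g h gs hs; rewrite pairs0.
have [[u w] _ uw] := seq_argmax (fun gh => mdist (act gh.1 o) (act gh.2 o)) pairs0.
exists (Num.bound `|mdist (act u o) (act w o)|) => g h gs hs.
apply: le_lt_trans (archi_boundP (normr_ge0 _)).
by rewrite (le_trans (uw _ (inP g h gs hs)))// ler_norm.
Qed.

(** m is the midpoint of two points at maximal distance d. *)
Lemma support_centre v k : diam_lt v k -> exists (d : R) (m : H),
  (forall g h, g \in supp_mod v -> h \in supp_mod v ->
     mdist (act g o) (act h o) <= d) /\
  (supp_mod v != [::] -> d < k%:R /\ forall w B,
     (forall g, g \in supp_mod v -> mdist (act g o) w <= B) ->
     mdist m w <= B - d / 2 + 2).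
Proof.
move=> vk; have [->|v0] := eqVneq (supp_mod v) [::]; first by exists 0, o; split.
pose pairs := [seq (g, h) | g <- supp_mod v, h <- supp_mod v].
have pairs0 : pairs != [::].
  by rewrite /pairs; case: (supp_mod v) v0.
have [[u w] uw dmax] := seq_argmax (fun gh => mdist (act gh.1 o) (act gh.2 o)) pairs0.
have [/= us ws] : u \in supp_mod v /\ w \in supp_mod v.
  by move: uw => /allpairsP[[u' w'] /= [? ? [-> ->]]].
have [m [mu mw]] := midpoint_exists (act u o) (act w o).
exists (mdist (act u o) (act w o)), m; split=> [g h gs hs|_].
  by apply: (dmax (g, h)); apply/allpairsP; exists (g, h).
split=> [|z B vB]; first exact: vk.
apply: le_trans (midpoint_close four_point z mu mw) _.
by rewrite lerD2r lerD2r ge_max !vB.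
Qed.

Section Reduction.
Variables (r : 'I_n -> AX) (D : 'I_n -> nat).
Hypothesis rD : forall i, diam_lt (r i) (D i).
Variables (v : 'rV[A]_n) (i1 : 'I_n).
Hypothesis v_relation : divides p (lincomb r v).
Hypothesis i1_support : supp_mod (r i1) != [::].
Hypothesis v_i1 : ~ divides p (v 0 i1).

Let U : {fset G} := \big[fsetU/fset0]_(i : 'I_n) msupp (v 0 i).
Let T : finType := ('I_n * U)%type.
Let coef (x : T) : int := (v 0 x.1)@_(val x.2).
(** Terms of v that vanish modulo p get no points, and so do not take part in any
    overlap. *)
Let points (x : T) : seq H := if (p %| coef x)%Z then [::]
  else [seq act (val x.2 * h)%g o | h <- supp_mod (r x.1)].
Let part (K : pred T) : 'rV[A]_n :=
  \row_j \sum_(g : U | K (j, g)) group_elt (val g) *~ coef (j, g).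

Let part_entry K x h : entry (lincomb r (part K)) x h =
  \sum_(y : T | K y) coef y * entry (r y.1) x ((val y.2)^-1 * h)%g.
Proof.
rewrite {1}/entry /lincomb !raddf_sum /=.
rewrite (eq_bigl (fun y : T => true && K (y.1, y.2))); last by case.
rewrite -(pair_big_dep xpredT (fun i (g : U) => K (i, g))
  (fun i (g : U) => coef (i, g) * entry (r i) x ((val g)^-1 * h)%g)) /=.
apply: eq_bigr => j _; rewrite mcoeffZ mxE mulr_suml raddf_sum /=.
apply: eq_bigr => g _; rewrite mulrzAl mcoeffMz mcoeff_group_eltM.
by rewrite mulrzz mulrC.
Qed.

Let part_full : part predT = v.
Proof.
apply/rowP => j; rewrite mxE.
have jU : (msupp (v 0 j) `<=` U)%fset by rewrite /U (bigD1 j) //= fsubsetUl.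
rewrite [RHS]group_eltE (big_fset_incl _ jU) => [|g _ /mcoeff_outdom ->]; last first.
  by rewrite mulr0z.
by rewrite [RHS]big_seq_fsetE.
Qed.

Let part_split K x h :
  (p %| entry (lincomb r (part K)) x h + entry (lincomb r (part (predC K))) x h)%Z.
Proof.
have <- : entry (lincomb r (part predT)) x h =
    entry (lincomb r (part K)) x h + entry (lincomb r (part (predC K))) x h.
  apply: (etrans (part_entry predT x h)); rewrite (bigID K) /=.
  exact/esym/(congr2 +%R (part_entry K x h) (part_entry (predC K) x h)).
rewrite part_full; have [w ->] := v_relation.
by rewrite /entry !mcoeffMn pmulrn mulrzz dvdz_mull.
Qed.

Let part_point K x h : ~~ (p %| entry (lincomb r (part K)) x h)%Z ->
  exists2 y, K y & act h o \in points y.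
Proof.
move=> ph; apply: contrapT => noy; move: ph; rewrite part_entry => /negP[].
apply: (big_ind (fun z : int => (p %| z)%Z)) => [||y Ky]; first exact: dvdz0.
  by move=> a b; exact: rpredD.
apply/negPn/negP => py; apply: noy; exists y => //; rewrite /points.
have -> : (p %| coef y)%Z = false by apply/negP => pc; rewrite dvdz_mulr in py.
apply/mapP; exists ((val y.2)^-1 * h)%g; last by rewrite mulgA mulgV mul1g.
by apply/supp_modP; exists x; apply: contra py => py; exact: dvdz_mull.
Qed.

(** Apply exists_cluster to the translates in the relation, and let w be the part
    of v that belongs to the cluster. Where the partial sum is nonzero modulo
    p, the rest of the sum is nonzero as well, so such a point is covered both
    inside and outside the cluster. *)
Lemma reduction : exists (w : 'rV[A]_n) (i0 : 'I_n) (c : int) (g : G),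
  [/\ ~~ (p %| c)%Z, w 0 i0 = group_elt g *~ c, (0 < D i0)%N &
   diam_lt (lincomb r w) (D i0).-1].
Proof.
have [d /boolp.choice[m dm]] := boolp.choice (fun i => support_centre (@rD i)).
pose centre (x : T) := act (val x.2) (m x.1).
have actV g z w : mdist (act g z) w = mdist z (act g^-1%g w).
  rewrite -(isometric_action_dist act_iso g z) -(isometric_actionM act_iso) mulgV.
  by rewrite isometric_action1.
have pointsP x s : s \in points x -> exists2 h, h \in supp_mod (r x.1) &
    s = act (val x.2) (act h o).
  rewrite /points; case: ifP => // _ /mapP[h hs ->]; exists h => //.
  by rewrite isometric_actionM.
have points_support x h : points x != [::] -> h \in supp_mod (r x.1) ->
    act (val x.2) (act h o) \in points x.
  rewrite /points; case: ifP => // _ _ hs; apply/mapP; exists h => //.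
  by rewrite isometric_actionM.
have points0 x : points x != [::] -> supp_mod (r x.1) != [::].
  by rewrite /points; case: ifP => //; case: (supp_mod _).
have diam x s t : s \in points x -> t \in points x -> mdist s t <= d x.1.
  move=> /pointsP[g gs ->] /pointsP[h hs ->].
  by rewrite isometric_action_dist//; apply: (dm x.1).1.
have close x w B : points x != [::] -> (forall s, s \in points x -> mdist s w <= B) ->
    mdist (centre x) w <= B - d x.1 / 2 + 2.
  move=> x0 xB; rewrite actV; apply: ((dm x.1).2 (points0 _ x0)).2 => g gs.
  by rewrite -actV; apply: xB; apply: points_support.
have sep x y : points x != [::] -> points y != [::] -> x.1 = y.1 ->
    mdist (centre x) (centre y) <= separation R n l -> x = y.
  move=> _ _; case: x y => [i g] [j h] /= <-{j}; rewrite /centre /= => gh.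
  congr (_, _); apply/val_inj/eqP; apply: contraT => neq_gh.
  have hg1 : ((val h)^-1 * val g)%g <> 1%g.
    move=> hg1; case/eqP: neq_gh.
    by rewrite -[LHS]mul1g -(mulgV (val h)) -mulgA hg1 mulg1.
  have := act_far (m i) hg1; rewrite ltNge isometric_actionM// metric_sym.
  by rewrite -actV metric_sym gh.
have [[x0 q] x0q qmax] : exists2 xq : T * H, xq.2 \in points xq.1 &
    forall y s, s \in points y -> mdist s o <= mdist xq.2 o.
  pose all_points := flatten [seq [seq (x, s) | s <- points x] | x <- enum T].
  have allP x s : ((x, s) \in all_points) = (s \in points x).
    apply/flatten_mapP/idP => [[y _ /mapP[t ty [-> ->]]]//|sx].
    by exists x; rewrite ?mem_enum//; apply/mapP; exists s.
  have all0 : all_points != [::].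
    have [g pg] : exists g, ~~ (p %| (v 0%R i1)@_g)%Z.
      apply: contrapT => nog; apply: v_i1; apply: divides_coef => g.
      by apply/negPn/negP => pg; apply: nog; exists g.
    have gU : g \in U.
      rewrite /U (bigD1 i1) //= inE -mcoeff_neq0; apply/orP; left.
      by apply: contraNneq pg => ->; rewrite dvdz0.
    have [h hs] : exists h, h \in supp_mod (r i1).
      by case: (supp_mod _) i1_support => // h s _; exists h; rewrite mem_head.
    have : (((i1, [` gU]%fset) : T), act (g * h)%g o) \in all_points.
      rewrite allP /points /coef /= (negPf pg).
      by apply/mapP; exists h.
    by case: (all_points).
  have [[x q] xq qmax] := seq_argmax (fun xs => mdist xs.2 o) all0.
  exists (x, q) => [|y s sy]; first by rewrite -allP.
  by apply: (qmax (y, s)); rewrite allP.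
have [K [x1 [Kx1 x1_points x1_uniq Kdiam]]] :=
  exists_cluster four_point qmax diam close sep l_large (lexx _) x0q erefl.
have pc : ~~ (p %| coef x1)%Z by move: x1_points; rewrite /points; case: ifP.
have [d_lt _] := (dm x1.1).2 (points0 _ x1_points).
have d_ge0 : 0 <= d x1.1.
  have : exists s, s \in points x1.
    by case: (points x1) x1_points => // s ? _; exists s; rewrite mem_head.
  by move=> [s sx1]; rewrite (le_trans _ (diam _ _ _ sx1 sx1)) ?mdist_ge0.
have D_gt0 : (0 < D x1.1)%N by rewrite -(ltr_nat R) (le_lt_trans d_ge0).
exists (part K), x1.1, (coef x1), (val x1.2); split=> //.
  rewrite mxE (big_pred1 x1.2) => [|g /=]; first by case: (x1).
  apply/idP/eqP => [Kg|->]; last by case: (x1) Kx1.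
  by have := x1_uniq _ Kg erefl; case: (x1) => ? ? [->].
have outside h : h \in supp_mod (lincomb r (part K)) ->
    exists x y, [/\ K x, ~~ K y, act h o \in points x & act h o \in points y].
  move=> /supp_modP[z pz].
  have [x Kx xh] := part_point pz.
  have [y Ky yh] : exists2 y, predC K y & act h o \in points y.
    apply: (@part_point _ z); apply: contra pz => pz.
    by have := part_split K z h; rewrite (rpredDr _ pz).
  by exists x, y.
move=> g h /outside[x [y [Kx Ky xg yg]]] /outside[x' [y' [Kx' Ky' xh yh]]].
apply: le_lt_trans (Kdiam _ _ _ _ _ _ Kx Kx' Ky Ky' xg yg xh yh) _.
by rewrite -subn1 natrB// ltrD2r.
Qed.

End Reduction.

(** Project onto the coordinates of those r i that vanish modulo p. *)
Lemma splits_mod_free (r : 'I_n -> AX) :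
  (forall v : 'rV[A]_n, divides p (lincomb r v) ->
     forall i, supp_mod (r i) != [::] -> divides p (v 0 i)) -> splits_mod r p.
Proof.
move=> all_div; pose z i := supp_mod (r i) == [::].
exists (\matrix_(i, j) ((i == j) && z i)%:R), 1.
have zE u : u *m (\matrix_(i, j) ((i == j) && z i)%:R) =
    \row_j (u 0 j *+ z j) :> 'rV[A]_n.
  apply/rowP => j; rewrite !mxE (bigD1 j) //= mxE eqxx /= big1 ?addr0 => [|i ij].
    by rewrite mulr_natr.
  by rewrite mxE (negPf ij) mulr0.
split=> [|u|v rv].
- by case: p0 => [->//|]; case: (p) => [|[]].
- rewrite zE; apply: divides_sum => i _; rewrite mxE.
  have [ri|ri] := boolP (z i); last by rewrite mulr0n scale0r; exact: divides0.
  have [w ->] := divides_support (eqP ri).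
  by exists (u 0 i *: w); rewrite mulr1n scalerMnr.
rewrite zE mulr1z; rewrite [X in divides _ X]row_sum_delta.
apply: divides_sum => i _; rewrite !mxE.
have [ri|ri] := boolP (z i); first by rewrite mulr1n subrr scale0r; exact: divides0.
have [w ->] := all_div v rv i ri.
by exists (- w *: delta_mx 0 i); rewrite mulr0n sub0r -mulNrn scalerMnl.
Qed.

(** Induction on the sum of the diameter bounds D i, by reduction. *)
Lemma splits_mod_act (r : 'I_n -> AX) : splits_mod r p.
Proof.
have [D rD] : exists D : 'I_n -> nat, forall i, diam_lt (r i) (D i).
  by have [D rD] := boolp.choice (fun i => exists_diam_lt (r i)); exists D.
move: {-1}(\sum_i D i)%N (leqnn (\sum_i D i)%N) => k.
elim: k r D rD => [|k IH] r D rD Dk; last first.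
  have [all_div|] := pselect (forall v : 'rV[A]_n, divides p (lincomb r v) ->
      forall i, supp_mod (r i) != [::] -> divides p (v 0 i)).
    exact: splits_mod_free.
  move=> /existsNP[v /not_implyP[rv /existsNP[i1 /not_implyP[ri1 vi1]]]].
  have [w [i0 [c [g [pc wi0 Di0 wD]]]]] := reduction rD rv ri1 vi1.
  apply: (splits_mod_replace p0 pc _ wi0 (h := group_elt g^-1%g)).
    by rewrite -group_eltM mulVg group_elt1.
  apply: (IH _ (fun i => if i == i0 then (D i).-1 else D i)).
    by move=> i; case: eqP => [->|].
  rewrite (bigD1 i0) //= eqxx; move: Dk; rewrite (bigD1 i0) //=.
  rewrite [X in (_ + X <= k)%N](eq_bigr D) => [|i /negPf -> //].
  by move: Di0; clear; lia.
apply: splits_mod_free => v _ i; case E: (supp_mod (r i)) => [//|h s] _.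
have hi : h \in supp_mod (r i) by rewrite E mem_head.
have Di : D i = 0%N by apply/eqP; move: Dk; rewrite leqn0 sum_nat_eq0 => /forallP/(_ i).
by have := rD i h h hi hi; rewrite Di mdistxx ltxx.
Qed.

End Local.

(** * Numerical bounds and conclusion *)

(** Pair the factor i + 1 of one factorial with the factor n + 1 - i of the
    other: their product is at least n + 1. *)
Lemma expn_le_fact_sqr n : (n.+1 ^ n.+1 <= n.+1`! ^ 2)%N.
Proof.
have factE : n.+1`! = (\prod_(i < n.+1) i.+1)%N.
  by rewrite fact_prod big_add1 /= big_mkord.
have -> : (n.+1`! ^ 2 = \prod_(i < n.+1) (i.+1 * (n.+1 - i)))%N.
  rewrite big_split /= -mulnn; congr (_ * _)%N => //.
  rewrite factE (reindex_inj rev_ord_inj) /=; apply: eq_bigr => i _.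
  by have := ltn_ord i; lia.
rewrite -[X in (_ ^ X)%N]card_ord -prod_nat_const; apply: leq_prod => i _.
have := ltn_ord i; nia.
Qed.

Lemma exp2_le_fact n : (2 ^ n <= n.+1`!)%N.
Proof. by elim: n => // n IH; rewrite expnS factS leq_mul. Qed.

Section Displacement.
Variable R : realType.

Lemma le_log2 (k j m : nat) : (0 < m)%N -> (2 ^ k <= m ^ j)%N ->
  k%:R <= j%:R * log2 (m%:R : R).
Proof.
move=> m0 km; have ln2 : 0 < ln (2 : R) by rewrite ln_gt0// ltr1n.
have m0' : 0 < (m%:R : R) by rewrite ltr0n.
rewrite /log2 mulrA ler_pdivlMr// mulr_natl -lnXn// mulr_natl -lnXn// ler_ln ?posrE ?exprn_gt0//.
by rewrite -!natrX ler_nat.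
Qed.

(** With t = trunc_log 2 n and L = log2 ((n + 1)!), the separation is at most
    n * (8 * t + 59), while n * t <= 2 * L because 2 ^ t <= n, and n <= L. *)
Lemma displacement_bound n (l := (trunc_log 2 n + 3)%N) : (0 < n)%N ->
  separation R n l <= 100 * log2 ((n.+1)`!%:R : R).
Proof.
move=> n0; rewrite /separation /l; set t := trunc_log 2 n.
have nt : (n * t)%:R <= 2%:R * log2 ((n.+1)`!%:R : R).
  apply: le_log2; first exact: fact_gt0.
  apply: leq_trans (expn_le_fact_sqr n).
  apply: (@leq_trans (n.+1 ^ n)%N); last by rewrite leq_exp2l.
  by rewrite mulnC expnM leq_exp2r// (leq_trans (trunc_logP _ n0)).
have n1 : n%:R <= 1%:R * log2 ((n.+1)`!%:R : R).
  by apply: le_log2; rewrite ?fact_gt0// expn1 exp2_le_fact.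
have tn : t%:R <= (n * t)%:R :> R by rewrite ler_nat leq_pmull.
have n1' : 1 <= n%:R :> R by rewrite ler1n.
by move: nt tn; rewrite natrD natrM => nt tn; lra.
Qed.

Lemma trunc_log_large n : (2 * n + 3 <= 2 ^ (trunc_log 2 n + 3))%N.
Proof.
have := trunc_log_ltn n (isT : 1 < 2)%N; rewrite (addn3 (trunc_log 2 n)) !expnS.
move: (2 ^ _)%N => m; lia.
Qed.

Lemma displacement_lt (G : groupType) (H : metricType R) (act : G -> H -> H) (c : R) :
  (c%:E < minimal_displacement act)%E ->
  forall g q, g <> 1%g -> c < mdist (act g q) q.
Proof.
move=> act_c g q g1; rewrite -lte_fin; apply: lt_le_trans act_c _.
by apply: ereal_inf_lbound; exists (g, q).
Qed.
End Displacement.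

Lemma torsion_free_malg (X : choiceType) (V : zmodType) :
  torsion_free V -> torsion_free {malg V[X]}.
Proof.
move=> V_tf v k k0 vk; apply/malgP => x; rewrite mcoeff0; apply: (V_tf _ k k0).
by rewrite -mcoeffMn vk mcoeff0.
Qed.

Lemma torsion_free_int : torsion_free int.
Proof. by move=> z k k0 /eqP; rewrite mulrn_eq0 => /orP[/eqP k0'|/eqP//]; lia. Qed.

Theorem theorem8 (R : realType) (n : nat) (n_ge1 : (1 <= n)%N)
    (G : groupType) (G_n_relator : n_relator_group n G)
    (H : metricType R) (H_hyperbolic : hyperbolic_space 1 H)
    (act : G -> H -> H) (act_isometric : isometric_action act)
    (act_displacement :
      ((100 * log2 ((n.+1)`!)%:R)%:E < minimal_displacement act)%E) :
  cohomological_dimension_le G 2.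
Proof.
have [X [r [f [f_onto f_ker]]]] := G_n_relator.
have [q0 _] := hyperbolic_nonempty H_hyperbolic.
have act_far g q : g <> 1%g ->
    separation R n (trunc_log 2 n + 3) < mdist (act g q) q.
  move=> g1; apply: le_lt_trans (displacement_bound R n_ge1) _.
  exact: displacement_lt act_displacement _ _ g1.
have A_tf : torsion_free (group_ring G) := torsion_free_malg torsion_free_int.
have [P [rP P_id]] : exists P : 'M[group_ring G]_n,
    (forall u, lincomb (fun i => fox f (r i)) (u *m P) = 0) /\
    (forall v, lincomb (fun i => fox f (r i)) v = 0 -> v *m P = v).
  apply: (kernel_projection A_tf (torsion_free_malg A_tf)) => [w k v k0 wv|p p0].
    apply: (fox_exact f_onto f_ker); apply: (A_tf _ k k0).
    rewrite -(raddfMn (relation_boundary f)) wv; exact: boundary_relator f_ker v.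
  exact: (splits_mod_act H_hyperbolic act_isometric (trunc_log_large n) act_far p0 q0).
exact: (resolution_of_projection f_onto f_ker rP P_id).
Qed.
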